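(* For any $f\in L^2(I)$, $h\in L^2(J)$, $\psi\in H^2$, $M\ge 0$ and $b\in H^\infty$ the finite Blaschke product $b(z)=e^{i\phi_0}\prod_{j=1}^N\frac{z-z_j}{1-\bar z_j z}$, there exists a unique solution to the bounded extremal problem $$\min_{g\in\mathcal B_{M,h}^{\psi,b}}\|\psi+bg-f\|_{L^2(I)},\qquad \mathcal B_{M,h}^{\psi,b}:=\{g\in H^2:\ \|\psi+bg-h\|_{L^2(J)}\le M\},$$ i.e. there is exactly one $g_0\in\mathcal B_{M,h}^{\psi,b}$ attaining this minimum.
   Context: $\mathbb D$ is the open unit disk of $\mathbb C$ and $\mathbb T$ the unit circle. $\mathbb T=I\cup J$ where $I$ and $J=\mathbb T\setminus I$ are Lebesgue measurable sets, both of positive measure. $L^2$ spaces on $\mathbb T$, $I$, $J$ are taken with respect to the normalized measure $\frac{1}{2\pi}d\theta$. $H^2$ is the Hardy space of the disk, identified through boundary values with the closed subspace of $L^2(\mathbb T)$ of functions whose Fourier coefficients of negative index vanish; $H^\infty$ is the space of bounded holomorphic functions on $\mathbb D$. The points $z_1,\dots,z_N\in\mathbb D$ are distinct and $\phi_0\in[0,2\pi]$ is a constant.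
   Formalization: For M = 0 the formal statement additionally assumes that the class B_{M,h}^{psi,b} is nonempty; it can be empty (e.g. psi = 0 and h the indicator of half of J), and then no minimizer exists. *)

(* Defs.v *)
From HB Require Import structures.
From mathcomp Require Import all_boot all_order all_algebra.
From mathcomp Require Import complex.
From mathcomp Require Import all_classical all_reals all_analysis.
Set Implicit Arguments.
Unset Strict Implicit.
Unset Printing Implicit Defensive.
Import Order.TTheory GRing.Theory Num.Theory.
Import numFieldNormedType.Exports.
Local Open Scope classical_set_scope.
Local Open Scope ring_scope.

Section circle.
Context {R : realType}.
Implicit Types (A : set R[i]) (F G : R[i] -> R[i]).

(* Functions on the circle are represented by functions R[i] -> R[i]: only the
   values at points of modulus 1 are ever used, and these up to null sets.
   Measurability and integration on the circle are those of the angle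
   t in [0, 2pi[, for Lebesgue (not merely Borel) measurable sets, hence the
   completed Lebesgue measure. *)

Definition circle : set R[i] := [set z | `|z| = 1].

Definition expi (t : R) : R[i] := Complex (cos t) (sin t).

Definition angles A : set R := [set t | 0 <= t < 2 * pi /\ A (expi t)].

Local Notation leb := (@completed_lebesgue_measure R).
Local Notation lebT := (caratheodory_type (wlength (@idfun R))^*%mu).

Definition circle_measurable A : Prop := measurable (angles A : set lebT).

Definition circle_measure A : \bar R := ((2 * pi)^-1%:E * leb (angles A))%E.

Definition circle_measurable_fun A F : Prop :=
  measurable_fun (angles A : set lebT) (fun t => complex.Re (F (expi t))) /\
  measurable_fun (angles A : set lebT) (fun t => complex.Im (F (expi t))).

Definition circle_ae_eq F G : Prop :=
  {ae leb, forall t, 0 <= t < 2 * pi -> F (expi t) = G (expi t)}.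

(* Valued in [0, +oo], so that it is +oo on functions that are not square
   integrable. *)
Definition L2norm A F : \bar R :=
  (((2 * pi)^-1%:E *
    \int[leb]_(t in angles A) (ComplexField.Normc.normc (F (expi t)) ^+ 2)%:E)
   `^ 2^-1)%E.

Definition L2 A F : Prop :=
  circle_measurable_fun A F /\ (L2norm A F < +oo)%E.

Definition fourier F (n : int) : R[i] :=
  let c t := F (expi t) * expi (- (n%:~R * t)) in
  Complex ((2 * pi)^-1 * Rintegral leb (angles circle) (fun t => complex.Re (c t)))
          ((2 * pi)^-1 * Rintegral leb (angles circle) (fun t => complex.Im (c t))).

(* The Hardy space of the disk, identified with its space of boundary values. *)
Definition H2 F : Prop :=
  L2 circle F /\ forall n : int, n < 0 -> fourier F n = 0.

Definition blaschke (phi0 : R) (N : nat) (z : 'I_N -> R[i]) (x : R[i]) : R[i] :=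
  expi phi0 * \prod_(j < N) ((x - z j) / (1 - (z j)^* * x)).

(* [admissible J psi b h M] is the class B_{M,h}^{psi,b}. *)
Definition admissible (J : set R[i]) (psi b h : R[i] -> R[i]) (M : R)
    (g : R[i] -> R[i]) : Prop :=
  H2 g /\ (L2norm J (fun x => psi x + b x * g x - h x)%R <= M%:E)%E.

Definition bep_solution (I J : set R[i]) (f h psi b : R[i] -> R[i]) (M : R)
    (g0 : R[i] -> R[i]) : Prop :=
  admissible J psi b h M g0 /\
  forall g, admissible J psi b h M g ->
    (L2norm I (fun x => psi x + b x * g0 x - f x)%R
     <= L2norm I (fun x => psi x + b x * g x - f x)%R)%E.

End circle.

(* Main.v *)
Require Import Defs.
From HB Require Import structures.
From mathcomp Require Import all_boot all_order all_algebra.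
From mathcomp Require Import complex.
From mathcomp Require Import all_classical all_reals all_analysis.
From mathcomp Require Import measurable_realfun.
From mathcomp Require Import ring lra zify.

(** Existence and uniqueness in the bounded extremal problem.

   On the circle [b] is unimodular, so [psi + b g] is as far from the data as
   [g] is from the single square integrable function
   [k = conjc b * (data - psi)], where the data are [f] on [I] and [h] on [J].
   The problem becomes: minimize the distance from [g] to [k] on [I], over the
   [g] in H2 whose distance to [k] on [J] is at most [M].  The angle moves
   everything to [[0, 2 pi[] with the completed Lebesgue measure, and squared
   norms are used throughout.

   The fact behind uniqueness and feasibility is that a function of H2 that
   vanishes on a set [A] of positive measure is zero ([hardy_unique]).  Among
   the functions of H2 that vanish on [A] and have a prescribed mean, let [g]
   have the least norm ([nearest_point]).  For [n > 0], adding a multiple of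
   [z^n g] changes neither the vanishing nor the mean, so [g] is orthogonal to
   [z^n g]; this says that [|g|^2] has no Fourier coefficient besides its mean,
   hence is constant ([modulus_constant]), hence zero since it vanishes on [A].
   So the prescribed mean had to be 0 ([vanishing_mean]).  Dividing by [z] and
   repeating kills all the coefficients.

   An integrable function without Fourier coefficients is zero
   ([trig_null_ae0]): it is orthogonal to trigonometric polynomials which
   converge boundedly to the indicator of an arc, so its integral over every
   arc is zero, then over every measurable set.

   Feasibility for [M > 0] is the density in L2(J) of the restrictions of H2
   ([hardy_dense]): the residual of a projection onto their closure, extended
   by 0 to [I], is orthogonal to H2, so its conjugate is in H2, and it vanishes
   on [I].

   For existence, the approximate minimizers are bounded on [I] by minimality
   and on [J] by the constraint.  They form decreasing convex sets; points of
   nearly least distance to [k] in these sets form a Cauchy sequence by the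
   parallelogram law, and the limit is a minimizer ([lexicographic_min],
   [L2_complete]).  For uniqueness, two minimizers agree on [I] by strict
   convexity of the norm, so their difference is in H2 and vanishes on a set of
   positive measure. *)

Set Implicit Arguments.
Unset Strict Implicit.
Unset Printing Implicit Defensive.
Import Order.TTheory GRing.Theory Num.Theory.
Import numFieldNormedType.Exports.
Local Open Scope classical_set_scope.
Local Open Scope ring_scope.

(** * Minimization over convex sets *)

Section lexicographic_minimum.
Variables (R : realType) (V : Type) (C : set V).
(* [q] measures the size that keeps minimizing sequences for [p] together;
   [d] is a squared distance, and [q_mid] one side of the parallelogram law. *)
Variables (mid : V -> V -> V) (d : V -> V -> R) (p q : V -> R) (Bd : R).
Hypothesis midC : forall u v, C u -> C v -> C (mid u v).
Hypothesis p_ge0 : forall u, C u -> 0 <= p u.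
Hypothesis q_ge0 : forall u, C u -> 0 <= q u.
Hypothesis p_mid : forall u v c, C u -> C v -> p u <= c -> p v <= c ->
  p (mid u v) <= c.
Hypothesis q_mid : forall u v, C u -> C v ->
  4 * q (mid u v) + d u v <= 2 * (q u + q v).
Hypothesis complete_lsc : forall u : nat -> V, (forall n, C (u n)) ->
  (forall e, 0 < e -> exists N, forall n k, (N <= n)%N -> (N <= k)%N ->
     d (u n) (u k) <= e) ->
  exists2 g, C g & forall e, 0 < e -> exists N, forall n, (N <= n)%N ->
     p g <= p (u n) + e /\ q g <= q (u n) + e.
Hypothesis near_min_bounded : forall e, 0 < e ->
  exists g, [/\ C g, forall g', C g' -> p g <= p g' + e & q g <= Bd].

(** The set of [e]-approximate minimizers of [p] is convex and shrinks with [e],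
   so the infimum of [q] over it increases to some finite [S].  Points where [q]
   is close to [S] are close to each other, because [q] at their midpoint cannot
   be much below [S].  Their limit minimizes [p], and [q] among the minimizers
   of [p]. *)
Lemma lexicographic_min : exists g, [/\ C g, forall g', C g' -> p g <= p g' &
  forall g', C g' -> p g' <= p g -> q g <= q g'].
Proof.
pose m := inf (p @` C).
have C0 : exists g, C g.
  by have [g [Cg _ _]] := near_min_bounded ltr01; exists g.
have lbC : has_lbound (p @` C) by exists 0 => _ [u Cu <-]; exact: p_ge0.
have m_le u : C u -> m <= p u by move=> Cu; apply: ge_inf => //; exists u.
pose Ce e := [set u | C u /\ p u <= m + e].
have CeB e : 0 < e -> exists2 g, Ce e g & q g <= Bd.
  move=> e0; have [g [Cg pg qg]] := near_min_bounded e0; exists g => //.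
  split=> //; rewrite -lerBlDr; apply: lb_le_inf.
    by have [u Cu] := C0; exists (p u), u.
  by move=> _ [u Cu <-]; rewrite lerBlDr; exact: pg.
pose dd e := inf (q @` Ce e).
have lbCe e : has_lbound (q @` Ce e).
  by exists 0 => _ [u [Cu _] <-]; exact: q_ge0.
have dd_le e u : Ce e u -> dd e <= q u.
  by move=> Cu; apply: ge_inf => //; exists u.
have Ce_mono e e' u : e <= e' -> Ce e u -> Ce e' u.
  by move=> ee' [Cu pu]; split=> //; apply: (le_trans pu); rewrite lerD2l.
have dd_anti e e' : 0 < e -> e <= e' -> dd e' <= dd e.
  move=> e0 ee'; apply: lb_le_inf.
    by have [u Cu _] := CeB _ e0; exists (q u), u.
  by move=> _ [u Cu <-]; apply: dd_le; exact: Ce_mono Cu.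
pose E := [set dd e | e in [set e | 0 < e]].
pose S := sup E.
have hsE : has_sup E.
  split; first by exists (dd 1); exists 1 => //=; exact: ltr01.
  exists Bd => _ [e e0 <-]; have [u Cu qu] := CeB e e0.
  exact: le_trans (dd_le _ _ Cu) qu.
have dd_S e : 0 < e -> dd e <= S.
  by move=> e0; apply: ub_le_sup; [exact: hsE.2|exists e].
have pick t : 0 < t -> exists eu : R * V, [/\ 0 < eu.1, eu.1 <= t,
    S - t < dd eu.1, Ce eu.1 eu.2 & q eu.2 <= S + t].
  move=> t0; have [_ [e /= e0 <-] Se] := sup_adherent t0 hsE.
  pose e' := Num.min e t.
  have e'0 : 0 < e' by rewrite lt_min e0 t0.
  (* Decreasing [e] only brings the infimum closer to [S]. *)
  have Se' : S - t < dd e'.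
    by apply: (lt_le_trans Se); apply: dd_anti => //; rewrite ge_min lexx.
  have : has_inf (q @` Ce e').
    split; last exact: lbCe.
    by have [u Cu _] := CeB _ e'0; exists (q u), u.
  move=> /(inf_adherent t0) [_ [u Cu <-] qu].
  exists (e', u); split=> //=; first by rewrite ge_min lexx orbT.
  by apply: (le_trans (ltW qu)); rewrite lerD2r; exact: dd_S.
pose t (n : nat) : R := n.+1%:R^-1.
have t0 n : 0 < t n by rewrite invr_gt0.
pose eu n := projT1 (cid (pick _ (t0 n))).
have euP n : [/\ 0 < (eu n).1, (eu n).1 <= t n,
    S - t n < dd (eu n).1, Ce (eu n).1 (eu n).2 & q (eu n).2 <= S + t n].
  by rewrite /eu; case: cid.
have t_small e : 0 < e -> exists N, forall n, (N <= n)%N -> t n <= e.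
  move=> e0; have [N _ HN] := near_infty_natSinv_lt (PosNum e0).
  by exists N => n Nn; apply/ltW/HN.
have Cu n : C (eu n).2 by have [_ _ _ []] := euP n.
have d_le n k : d (eu n).2 (eu k).2 <= 6 * (t n + t k).
  have [e0 et Se [_ pu] qu] := euP n.
  have [e0' et' Se' [_ pu'] qu'] := euP k.
  pose e' := Num.max (eu n).1 (eu k).1.
  have Cm : Ce e' (mid (eu n).2 (eu k).2).
    split; first exact: midC.
    apply: p_mid => //; [apply: (le_trans pu)|apply: (le_trans pu')];
      by rewrite lerD2l le_max lexx ?orbT.
  have Sm : S - (t n + t k) < q (mid (eu n).2 (eu k).2).
    apply: lt_le_trans (dd_le _ _ Cm).
    rewrite /e'; have := t0 n; have := t0 k.
    by case: (leP (eu n).1 (eu k).1) => _; lra.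
  have := q_mid (Cu n) (Cu k); lra.
have [|g Cg gP] := complete_lsc Cu.
  move=> e e0; have e12 : 0 < e / 12 by rewrite divr_gt0.
  have [N HN] := t_small _ e12; exists N => n k Nn Nk.
  apply: (le_trans (d_le n k)); have := HN _ Nn; have := HN _ Nk; lra.
have gP' e : 0 < e -> p g <= m + e /\ q g <= S + e.
  move=> e0; have e2 : 0 < e / 2 by rewrite divr_gt0.
  have [N1 HN1] := t_small _ e2; have [N2 HN2] := gP _ e2.
  have [] := HN2 (maxn N1 N2) (leq_maxr _ _).
  have := HN1 (maxn N1 N2) (leq_maxl _ _).
  have [_ ht _ [_ pu] qu] := euP (maxn N1 N2); lra.
have pgm : p g <= m by apply/ler_addgt0Pr => e /gP'[].
have qgS : q g <= S by apply/ler_addgt0Pr => e /gP'[].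
exists g; split=> // [g' Cg'|g' Cg' pg'].
  exact: le_trans (m_le _ Cg').
apply: (le_trans qgS); apply: ge_sup; first exact: hsE.1.
move=> _ [e /= e0 <-]; apply: dd_le; split=> //.
by apply: (le_trans pg'); apply: (le_trans pgm); rewrite lerDl ltW.
Qed.

End lexicographic_minimum.

(** * Square integrable complex functions *)

Section complex_coordinates.
Variable R : realType.
Implicit Types a b c : R[i].

Lemma ReD a b : complex.Re (a + b) = complex.Re a + complex.Re b.
Proof. by case: a; case: b. Qed.

Lemma ImD a b : complex.Im (a + b) = complex.Im a + complex.Im b.
Proof. by case: a; case: b. Qed.

Lemma ReN a : complex.Re (- a) = - complex.Re a. Proof. by case: a. Qed.

Lemma ImN a : complex.Im (- a) = - complex.Im a. Proof. by case: a. Qed.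

Lemma ReM a b : complex.Re (a * b) =
  complex.Re a * complex.Re b - complex.Im a * complex.Im b.
Proof. by case: a; case: b. Qed.

Lemma ImM a b : complex.Im (a * b) =
  complex.Re a * complex.Im b + complex.Im a * complex.Re b.
Proof. by case: a; case: b. Qed.

Lemma ReJ a : complex.Re (conjc a) = complex.Re a. Proof. by case: a. Qed.

Lemma ImJ a : complex.Im (conjc a) = - complex.Im a. Proof. by case: a. Qed.

Definition ReIm := (ReD, ImD, ReN, ImN, ReM, ImM, ReJ, ImJ).

(** The real inner product of the plane, the real part of [a * conjc b]. *)
Definition dotc a b : R :=
  complex.Re a * complex.Re b + complex.Im a * complex.Im b.

Definition nsq a : R := dotc a a.

Lemma nsq_ge0 a : 0 <= nsq a.
Proof. by rewrite /nsq /dotc addr_ge0// -expr2 sqr_ge0. Qed.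

Lemma nsq_eq0 a : nsq a = 0 -> a = 0.
Proof.
case: a => x y /eqP; rewrite /nsq /dotc /= -!expr2 paddr_eq0 ?sqr_ge0//.
by rewrite !sqrf_eq0 => /andP[/eqP-> /eqP->].
Qed.

Lemma nsq0 : nsq (0 : R[i]) = 0.
Proof. by rewrite /nsq /dotc/= mul0r addr0. Qed.

Lemma nsqM a b : nsq (a * b) = nsq a * nsq b.
Proof. by rewrite /nsq /dotc !ReIm; ring. Qed.

Lemma nsqJ a : nsq (conjc a) = nsq a.
Proof. by rewrite /nsq /dotc !ReIm; ring. Qed.

Lemma conjcM a b : conjc (a * b) = conjc a * conjc b.
Proof.
by apply/eqP; rewrite eq_complex !ReIm; apply/andP; split; apply/eqP; ring.
Qed.

Lemma nsqN a : nsq (- a) = nsq a.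
Proof. by rewrite /nsq /dotc !ReIm; ring. Qed.

Lemma dotcC a b : dotc a b = dotc b a.
Proof. by rewrite /dotc mulrC [X in _ + X]mulrC. Qed.

Lemma dotcMl a b c : dotc (c * a) b = dotc a (conjc c * b).
Proof. by rewrite /dotc !ReIm; ring. Qed.

Lemma nsqD_le a b : nsq (a + b) <= 2 * (nsq a + nsq b).
Proof. by have := nsq_ge0 (a - b); rewrite /nsq /dotc !ReIm; lra. Qed.

Lemma nsqB_le a b : nsq (a - b) <= 2 * (nsq a + nsq b).
Proof. by rewrite -(nsqN b); exact: nsqD_le. Qed.

(** The weight [e] stands in for the Cauchy-Schwarz inequality: it makes one of
   the two terms as small as needed. *)
Lemma dotc_le (e : R) a b : 0 < e -> `|dotc a b| <= e * nsq a + e^-1 * nsq b.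
Proof.
move=> e0.
suff H x y : `|x * y| <= (e * (x * x) + e^-1 * (y * y)).
  rewrite (le_trans (ler_normD _ _))// /nsq /dotc.
  have := H (complex.Re a) (complex.Re b); have := H (complex.Im a) (complex.Im b).
  lra.
have e00 : e != 0 by rewrite gt_eqF.
have ee : e * e^-1 = 1 by rewrite mulfV.
have ei0 : 0 < e^-1 by rewrite invr_gt0.
suff H2 : `|x * y| * 2 <= e * (x * x) + e^-1 * (y * y).
  by have := normr_ge0 (x * y); lra.
have [xy|xy] := ger0P (x * y).
- have : 0 <= e^-1 * (e * x - y) ^+ 2 by rewrite mulr_ge0 ?sqr_ge0// ltW.
  rewrite (_ : e^-1 * _ = e * e^-1 * e * (x * x) - 2 * (e * e^-1) * (x * y)
    + e^-1 * (y * y)); last by ring.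
  by rewrite ee; lra.
- have : 0 <= e^-1 * (e * x + y) ^+ 2 by rewrite mulr_ge0 ?sqr_ge0// ltW.
  rewrite (_ : e^-1 * _ = e * e^-1 * e * (x * x) + 2 * (e * e^-1) * (x * y)
    + e^-1 * (y * y)); last by ring.
  by rewrite ee; lra.
Qed.

Lemma norm_Re_le a : `|complex.Re a| ^+ 2 <= nsq a.
Proof. by rewrite real_normK ?num_real// /nsq /dotc -!expr2 lerDl sqr_ge0. Qed.

Lemma norm_Im_le a : `|complex.Im a| ^+ 2 <= nsq a.
Proof. by rewrite real_normK ?num_real// /nsq /dotc -!expr2 lerDr sqr_ge0. Qed.

End complex_coordinates.

Section square_integrable.
Context d (T : measurableType d) (R : realType).
Variables (mu : {measure set T -> \bar R}) (D : set T).
Hypothesis mD : measurable D.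
Implicit Types (u v w : T -> R[i]) (A : set T).

Definition cmeas u := measurable_fun D (fun t => complex.Re (u t)) /\
  measurable_fun D (fun t => complex.Im (u t)).

Record sqint u : Prop := Sqint {
  sqint_cmeas : cmeas u;
  sqint_integrable : mu.-integrable D (fun t => (nsq (u t))%:E) }.

Definition ip u v : R := \int[mu]_(t in D) dotc (u t) (v t).

(** The squared norm on a part [A] of the domain, so that the two criteria and
   the ambient norm are values of one function. *)
Definition nrm2 A u : R := \int[mu]_(t in A) nsq (u t).

Lemma ipE u v : ip u v = \int[mu]_(t in D) dotc (u t) (v t).
Proof. by []. Qed.

Lemma nrm2E A u : nrm2 A u = \int[mu]_(t in A) nsq (u t).
Proof. by []. Qed.

Lemma eq_ip u v u' v' : (forall t, dotc (u t) (v t) = dotc (u' t) (v' t)) ->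
  ip u v = ip u' v'.
Proof. by move=> e; apply: eq_Rintegral => t _. Qed.

Lemma eq_nrm2 A u v : (forall t, nsq (u t) = nsq (v t)) -> nrm2 A u = nrm2 A v.
Proof. by move=> e; apply: eq_Rintegral => t _. Qed.

Lemma le_integrableR (f g : T -> R) : measurable_fun D f ->
  (forall t, D t -> `|f t| <= g t) -> mu.-integrable D (EFin \o g) ->
  mu.-integrable D (EFin \o f).
Proof.
move=> mf fg; apply: le_integrable => //; first exact/measurable_EFinP.
by move=> t Dt /=; rewrite lee_fin (le_trans (fg _ Dt))// ler_norm.
Qed.

Lemma integrableDR (f g : T -> R) : mu.-integrable D (EFin \o f) ->
  mu.-integrable D (EFin \o g) -> mu.-integrable D (EFin \o (fun t => f t + g t)).
Proof.
move=> fi gi; exact: (integrableD mD fi gi).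
Qed.

Lemma integrableZR (k : R) (f : T -> R) : mu.-integrable D (EFin \o f) ->
  mu.-integrable D (EFin \o (fun t => k * f t)).
Proof.
move=> fi; exact: (integrableZl mD k fi).
Qed.

Lemma cmeasD u v : cmeas u -> cmeas v -> cmeas (fun t => u t + v t).
Proof.
move=> [u1 u2] [v1 v2]; split.
  by under eq_fun do rewrite ReD; exact: measurable_funD.
by under eq_fun do rewrite ImD; exact: measurable_funD.
Qed.

Lemma cmeasM u v : cmeas u -> cmeas v -> cmeas (fun t => u t * v t).
Proof.
move=> [u1 u2] [v1 v2]; split.
  by under eq_fun do rewrite ReM; apply: measurable_funB; exact: measurable_funM.
by under eq_fun do rewrite ImM; apply: measurable_funD; exact: measurable_funM.
Qed.

Lemma cmeas_cst a : cmeas (fun _ => a).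
Proof. by split; exact: measurable_cst. Qed.

Lemma cmeasN u : cmeas u -> cmeas (fun t => - u t).
Proof.
move=> [u1 u2]; split.
  by under eq_fun do rewrite ReN; exact: measurableT_comp.
by under eq_fun do rewrite ImN; exact: measurableT_comp.
Qed.

Lemma cmeasJ u : cmeas u -> cmeas (fun t => conjc (u t)).
Proof.
move=> [u1 u2]; split; first by under eq_fun do rewrite ReJ.
by under eq_fun do rewrite ImJ; exact: measurableT_comp.
Qed.

Lemma measurable_dotc u v : cmeas u -> cmeas v ->
  measurable_fun D (fun t => dotc (u t) (v t)).
Proof.
by move=> [u1 u2] [v1 v2]; apply: measurable_funD; exact: measurable_funM.
Qed.

Lemma sqint_le u v (k : R) : cmeas u -> sqint v ->
  (forall t, D t -> nsq (u t) <= k * nsq (v t)) -> sqint u.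
Proof.
move=> mu_ [mv iv] uv; split=> //.
apply: (@le_integrableR _ (fun t => k * nsq (v t))).
- exact: measurable_dotc.
- by move=> t Dt; rewrite ger0_norm ?nsq_ge0//; exact: uv.
- exact: integrableZR.
Qed.

Lemma sqintD u v : sqint u -> sqint v -> sqint (fun t => u t + v t).
Proof.
move=> [mu_ iu] [mv iv]; have muv := cmeasD mu_ mv; split=> //.
apply: (@le_integrableR _ (fun t => 2 * (nsq (u t) + nsq (v t)))).
- exact: measurable_dotc.
- by move=> t Dt; rewrite ger0_norm ?nsq_ge0//; exact: nsqD_le.
- by apply: integrableZR; exact: integrableDR.
Qed.

Lemma sqintM u v (k : R) : cmeas u -> (forall t, D t -> nsq (u t) <= k) ->
  sqint v -> sqint (fun t => u t * v t).
Proof.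
move=> mu_ uk [mv iv]; apply: (@sqint_le _ v k); first exact: cmeasM.
  by split.
by move=> t Dt; rewrite nsqM ler_wpM2r ?nsq_ge0//; exact: uk.
Qed.

Lemma sqintZ a u : sqint u -> sqint (fun t => a * u t).
Proof. by apply: (@sqintM _ _ (nsq a)) => //; exact: cmeas_cst. Qed.

Lemma sqintN u : sqint u -> sqint (fun t => - u t).
Proof.
move=> su; apply: (@sqint_le _ u 1) => //; first by apply: cmeasN; case: su.
by move=> t Dt; rewrite nsqN mul1r.
Qed.

Lemma sqintB u v : sqint u -> sqint v -> sqint (fun t => u t - v t).
Proof. by move=> su sv; apply: sqintD => //; exact: sqintN. Qed.

Lemma sqintJ u : sqint u -> sqint (fun t => conjc (u t)).
Proof.
move=> su; apply: (@sqint_le _ u 1) => //; first by apply: cmeasJ; case: su.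
by move=> t Dt; rewrite nsqJ mul1r.
Qed.

Lemma sqint0 : sqint (fun _ => 0).
Proof.
split; first exact: cmeas_cst.
by rewrite nsq0; exact: integrable0.
Qed.

Lemma dot_integrable u v : sqint u -> sqint v ->
  mu.-integrable D (fun t => (dotc (u t) (v t))%:E).
Proof.
move=> [mu_ iu] [mv iv].
apply: (@le_integrableR _ (fun t => nsq (u t) + nsq (v t))).
- exact: measurable_dotc.
- by move=> t _; have := dotc_le (u t) (v t) ltr01; rewrite invr1 !mul1r.
- exact: integrableDR.
Qed.

Lemma ipC u v : ip u v = ip v u.
Proof. by apply: eq_Rintegral => t _; exact: dotcC. Qed.

Lemma ipD u v w : sqint u -> sqint v -> sqint w ->
  ip (fun t => u t + v t) w = ip u w + ip v w.
Proof.
move=> su sv sw; rewrite /ip -RintegralD//; try exact: dot_integrable.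
by apply: eq_Rintegral => t _; rewrite /dotc !ReIm; ring.
Qed.

Lemma ipZ (k : R) u v : sqint u -> sqint v ->
  ip (fun t => k%:C%C * u t) v = k * ip u v.
Proof.
move=> su sv; rewrite /ip -RintegralZl//; last exact: dot_integrable.
by apply: eq_Rintegral => t _; rewrite /dotc !ReIm/=; ring.
Qed.

Lemma ipN u v : sqint u -> sqint v -> ip (fun t => - u t) v = - ip u v.
Proof.
move=> su sv; rewrite -mulN1r -ipZ//.
by apply: eq_Rintegral => t _; rewrite /dotc !ReIm/=; ring.
Qed.

Lemma ipB u v w : sqint u -> sqint v -> sqint w ->
  ip (fun t => u t - v t) w = ip u w - ip v w.
Proof. by move=> su sv sw; rewrite ipD ?ipN//; exact: sqintN. Qed.

Lemma ip0l u : ip (fun _ => 0) u = 0.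
Proof.
rewrite /ip (@eq_Rintegral _ _ _ mu D (fun=> 0)) ?Rintegral_cst ?mul0r//.
by move=> t _; rewrite /dotc !mul0r addr0.
Qed.

Lemma nrm2_ge0 A u : 0 <= nrm2 A u.
Proof. by apply: Rintegral_ge0 => t _; exact: nsq_ge0. Qed.

Lemma nsq_integrable A u : measurable A -> A `<=` D -> sqint u ->
  mu.-integrable A (fun t => (nsq (u t))%:E).
Proof. by move=> mA AD [_ iu]; exact: integrableS iu. Qed.

Lemma nrm2_subset A u : measurable A -> A `<=` D -> sqint u ->
  nrm2 A u <= nrm2 D u.
Proof.
move=> mA AD su; rewrite /nrm2 /Rintegral fine_le//.
- by apply: integrable_fin_num => //; exact: nsq_integrable.
- by apply: integrable_fin_num => //; case: su.
apply: ge0_subset_integral => //.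
- by case: su => _ /integrableP[].
- by move=> t _; rewrite lee_fin nsq_ge0.
Qed.

Lemma nrm2_le A u v w (k l : R) : measurable A -> A `<=` D ->
  sqint u -> sqint v -> sqint w ->
  (forall t, A t -> nsq (u t) <= k * nsq (v t) + l * nsq (w t)) ->
  nrm2 A u <= k * nrm2 A v + l * nrm2 A w.
Proof.
move=> mA AD su sv sw uvw.
have iv := nsq_integrable mA AD sv; have iw := nsq_integrable mA AD sw.
have ikv : mu.-integrable A (EFin \o (fun t => k * nsq (v t))).
  exact: (integrableZl mA k iv).
have ilw : mu.-integrable A (EFin \o (fun t => l * nsq (w t))).
  exact: (integrableZl mA l iw).
rewrite -!RintegralZl// -RintegralD//; apply: le_Rintegral => //.
- exact: nsq_integrable.
- exact: (integrableD mA ikv ilw).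
Qed.

Lemma sqint_mid u v : sqint u -> sqint v -> sqint (fun t => 2^-1 * (u t + v t)).
Proof. by move=> su sv; apply: sqintZ; exact: sqintD. Qed.

End square_integrable.

(** * Continuity of norms and inner products *)

Section hilbert_geometry.
Context d (T : measurableType d) (R : realType).
Variables (mu : {measure set T -> \bar R}) (D : set T).
Hypothesis mD : measurable D.
Implicit Types (u v w g k : T -> R[i]) (A : set T).
Local Notation sqint := (sqint mu D).
Local Notation ip := (ip mu D).
Local Notation nrm2 := (nrm2 mu).

Lemma nsqD_le_weighted (e : R) (a b : R[i]) : 0 < e ->
  nsq (a + b) <= (1 + 2 * e) * nsq a + (1 + 2 * e^-1) * nsq b.
Proof.
move=> e0; have := dotc_le a b e0; rewrite ler_norml => /andP[_].
rewrite (_ : nsq (a + b) = nsq a + 2 * dotc a b + nsq b); first lra.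
by rewrite /nsq /dotc !ReIm; ring.
Qed.

(** Lower semicontinuity of the distance to [k] on [A], uniformly in the
   approximant, which is how closed convex constraints pass to the limit. *)
Lemma nrm2_lsc A g k (e : R) : measurable A -> A `<=` D -> sqint g -> sqint k ->
  0 < e -> exists2 dl, 0 < dl & forall u, sqint u ->
    nrm2 D (fun t => g t - u t) <= dl ->
    nrm2 A (fun t => g t - k t) <= nrm2 A (fun t => u t - k t) + e.
Proof.
move=> mA AD sg sk e0.
set K := nrm2 A (fun t => g t - k t).
have K0 : 0 <= K by exact: nrm2_ge0.
(* Small enough that the error proportional to [K] is at most [e / 2]; the
   distance [dl] then absorbs the terms in [h^-1]. *)
pose h := e / (8 * (K + 1)).
have h0 : 0 < h by rewrite divr_gt0// mulr_gt0//; lra.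
have hK : 4 * h * K <= e / 2.
  have -> : 4 * h * K = e / 2 * (K / (K + 1)).
    by rewrite /h; field; rewrite ?gt_eqF//; lra.
  have : K / (K + 1) <= 1 by rewrite ler_pdivrMr ?mul1r; lra.
  by move: (K / (K + 1)) => x; nra.
have hi0 : 0 < h^-1 by rewrite invr_gt0.
pose c := 1 + 4 * h + 2 * h^-1.
have c0 : 0 < c by rewrite /c; lra.
exists (e / 2 / c); first by rewrite !divr_gt0.
move=> u su; rewrite ler_pdivlMr// => hX.
have sgu : sqint (fun t => g t - u t) by exact: sqintB.
have suk : sqint (fun t => u t - k t) by exact: sqintB.
have sgk : sqint (fun t => g t - k t) by exact: sqintB.
have XA := nrm2_subset mD mA AD sgu.
set X := nrm2 A (fun t => g t - u t) in XA.
have X0 : 0 <= X by exact: nrm2_ge0.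
set Y := nrm2 A (fun t => u t - k t).
have H1 : K <= (1 + 2 * h) * Y + (1 + 2 * h^-1) * X.
  apply: (nrm2_le mD) => // t _.
  have -> : g t - k t = (u t - k t) + (g t - u t) by ring.
  exact: nsqD_le_weighted.
have H2 : Y <= 2 * K + 2 * X.
  apply: (nrm2_le mD) => // t _; rewrite -mulrDr.
  have -> : u t - k t = (g t - k t) - (g t - u t) by ring.
  exact: nsqB_le.
have H3 : h * Y <= h * (2 * K + 2 * X) by rewrite ler_wpM2l// ltW.
have H4 : X * c <= e / 2 by apply: le_trans hX; rewrite ler_wpM2r// ltW.
move: H1 H3 H4; rewrite /c; lra.
Qed.

Lemma ip_le (h : R) u w : 0 < h -> sqint u -> sqint w ->
  `|ip u w| <= h * nrm2 D u + h^-1 * nrm2 D w.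
Proof.
move=> h0 su sw.
have iu : mu.-integrable D (EFin \o (fun t => h * nsq (u t))).
  by apply: integrableZR => //; case: su.
have iw : mu.-integrable D (EFin \o (fun t => h^-1 * nsq (w t))).
  by apply: integrableZR => //; case: sw.
apply: (le_trans (le_normr_Rintegral mD _)); first exact: dot_integrable.
rewrite -!RintegralZl//; [|by case: sw|by case: su].
rewrite -RintegralD//; apply: le_Rintegral => //.
- exact/integrable_norm/dot_integrable.
- exact: integrableDR.
- by move=> t _; exact: dotc_le.
Qed.

(** The inner product with a fixed vector is continuous, so a linear condition
   satisfied by arbitrarily good approximants holds in the limit. *)
Lemma ip_closed (a : R) u w : sqint u -> sqint w ->
  (forall e, 0 < e -> exists v, [/\ sqint v,
     nrm2 D (fun t => u t - v t) <= e & ip v w = a]) -> ip u w = a.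
Proof.
move=> su sw H; apply/eqP; rewrite -subr_eq0 -normr_le0.
apply/ler_addgt0Pr => e e0; rewrite add0r.
have W0 : 0 <= nrm2 D w by exact: nrm2_ge0.
pose h := 2 * (nrm2 D w + 1) / e.
have h0 : 0 < h by rewrite divr_gt0//; lra.
have e2h : 0 < e / 2 / h by apply: divr_gt0 => //; exact: divr_gt0.
have [v [sv uv <-]] := H _ e2h.
rewrite -ipB//; have suv := sqintB mD su sv.
apply: (le_trans (ip_le h0 suv sw)).
have H1 : h * nrm2 D (fun t => u t - v t) <= e / 2.
  by rewrite mulrC -ler_pdivlMr.
have H2 : h^-1 * nrm2 D w <= e / 2.
  have -> : h^-1 * nrm2 D w = e / 2 * (nrm2 D w / (nrm2 D w + 1)).
    by rewrite /h; field; rewrite ?gt_eqF//; lra.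
  have : nrm2 D w / (nrm2 D w + 1) <= 1 by rewrite ler_pdivrMr ?mul1r; lra.
  by move: (_ / (_ + 1)) => x; nra.
lra.
Qed.

Lemma nrm2_ip u : nrm2 D u = ip u u. Proof. by []. Qed.

(** The derivative at 0 of the norm along a line through its minimum. *)
Lemma min_orthogonal g v : sqint g -> sqint v ->
  (forall s : R, nrm2 D g <= nrm2 D (fun t => g t + s%:C%C * v t)) ->
  ip g v = 0.
Proof.
move=> sg sv H; set b := ip g v.
(* The increment [s = - b / c] nearly minimizes the quadratic polynomial in [s];
   adding 1 to the norm of [v] avoids a division by 0. *)
set c := nrm2 D v + 1.
have c0 : 0 < c by rewrite /c ltr_wpDl// nrm2_ge0.
have ci : c * c^-1 = 1 by rewrite mulfV// gt_eqF.
have := H (- b / c).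
have ssv : sqint (fun t => (- b / c)%:C%C * v t) by exact: sqintZ.
have -> : nrm2 D (fun t => g t + (- b / c)%:C%C * v t)
    = nrm2 D g + 2 * (- b / c) * b + (- b / c) ^+ 2 * nrm2 D v.
  rewrite !nrm2_ip ipD//; last exact: sqintD.
  rewrite (ipZ mD _ sv); last exact: sqintD.
  rewrite (ipC mu D g) (ipC mu D v) !ipD// !ipZ// (ipC mu D v g) -/b.
  by ring.
rewrite (_ : nrm2 D v = c - 1); last by rewrite /c; ring.
rewrite (_ : _ + _ = nrm2 D g - b ^+ 2 * c^-1 * (2 - c * c^-1 + c^-1)); last by ring.
rewrite ci => H1; have ci0 : 0 < c^-1 by rewrite invr_gt0.
apply/eqP; rewrite -sqrf_eq0 eq_le sqr_ge0 andbT.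
rewrite leNgt; apply/negP => b0.
have : 0 < b ^+ 2 * c^-1 * (2 - 1 + c^-1).
  by apply: mulr_gt0; [exact: mulr_gt0|lra].
lra.
Qed.

End hilbert_geometry.

(** * Completeness *)

Section riesz_fischer.
Context d (T : measurableType d) (R : realType).
Variables (mu : {measure set T -> \bar R}) (D : set T).
Hypothesis mD : measurable D.
Local Notation sqint := (sqint mu D).
Local Notation nrm2 := (nrm2 mu).

Lemma cvg_of_geometric_steps (x : nat -> R) (C : R) :
  (forall k, `|x k.+1 - x k| <= C / 2 ^+ k) -> cvgn x.
Proof.
move=> xC.
have C0 : 0 <= C by have := xC 0%N; rewrite expr0 divr1; exact: le_trans.
have -> : x = (fun n => x 0%N + series (telescope x) n).
  by apply/funext => n; exact: eq_sum_telescope.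
apply: is_cvgD; first exact: is_cvg_cst.
apply: normed_cvg.
apply: (@series_le_cvg _ _ (geometric C 2^-1)) => /= n.
- by rewrite normr_ge0.
- by rewrite mulr_ge0// exprn_ge0// invr_ge0.
- by rewrite exprVn; exact: xC.
- apply: is_cvg_geometric_series; rewrite ger0_norm ?invr_ge0//.
  by rewrite invf_lt1// ltr1n.
Qed.

(** With the weights [4 ^ k] the squared steps still have a summable integral, so
   almost everywhere their sum is some finite [s], which bounds the [k]-th step
   by a multiple of [2 ^- k]. *)
Lemma fast_cauchy_ae_cvg (v : nat -> T -> R[i]) : (forall k, sqint (v k)) ->
  (forall k, nrm2 D (fun t => v k.+1 t - v k t) <= (4 ^+ k * 2 ^+ k.+1)^-1) ->
  {ae mu, forall t, D t -> cvgn (fun k => complex.Re (v k t)) /\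
                           cvgn (fun k => complex.Im (v k t))}.
Proof.
move=> sv fast.
pose a k t := 4 ^+ k * nsq (v k.+1 t - v k t).
have a0 k t : 0 <= a k t by rewrite mulr_ge0 ?nsq_ge0// exprn_ge0.
have sdv k : sqint (fun t => v k.+1 t - v k t) by exact: sqintB.
have ia k : mu.-integrable D (EFin \o a k).
  by apply: integrableZR => //; case: (sdv k).
have ma k : measurable_fun D (EFin \o a k) by case/integrableP: (ia k).
pose S t := (\sum_(0 <= k <oo) (a k t)%:E)%E.
have S0 t : (0 <= S t)%E by apply: nneseries_ge0 => n _ _; rewrite lee_fin.
have iS : mu.-integrable D S.
  apply/integrableP; split.
    by apply: ge0_emeasurable_sum => [k t _ _|k _]; [rewrite lee_fin|exact: ma].
  under eq_integral do rewrite gee0_abs//.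
  rewrite integral_nneseries//; last by move=> n t _; rewrite lee_fin.
  apply: (@le_lt_trans _ _ 1%:E); last by rewrite ltry.
  apply: (le_trans _ (epsilon_trick0 xpredT ler01)).
  apply: lee_nneseries => [n _ _|n _].
    by apply: integral_ge0 => t _; rewrite lee_fin.
  rewrite -[leLHS]fineK; last exact: (integrable_fin_num mD (ia n)).
  rewrite lee_fin -[fine _]/(Rintegral mu D (a n)) RintegralZl//; last first.
    by case: (sdv n).
  have p4 : 0 < 4 ^+ n :> R by rewrite exprn_gt0.
  rewrite mulrC -ler_pdivlMr//; apply: (le_trans (fast n)).
  by rewrite invfM mulrC natrX mul1r.
have := integrable_ae mD iS; apply: filterS => t St Dt.
have {}St := St Dt; pose s := fine (S t).
have s0 : 0 <= s by exact: fine_ge0.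
have as_ k : a k t <= s.
  rewrite -lee_fin fineK//.
  apply: le_trans (nneseries_lim_ge k.+1 _); last by move=> n _ _; rewrite lee_fin.
  by rewrite big_nat_recr//= leeDr// sume_ge0// => n _; rewrite lee_fin.
have step k : nsq (v k.+1 t - v k t) <= ((s + 1) / 2 ^+ k) ^+ 2.
  have p4 : 0 < 4 ^+ k :> R by rewrite exprn_gt0.
  rewrite expr_div_n -exprM mulnC exprM (_ : 2 ^+ 2 = 4 :> R); last by ring.
  rewrite ler_pdivlMr// mulrC; apply: (le_trans (as_ k)); nra.
have bnd (x : R) k : `|x| ^+ 2 <= ((s + 1) / 2 ^+ k) ^+ 2 ->
    `|x| <= (s + 1) / 2 ^+ k.
  rewrite ler_pXn2r// ?nnegrE// divr_ge0 ?exprn_ge0//; lra.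
split; apply: (@cvg_of_geometric_steps _ (s + 1)) => k; apply: bnd.
- by rewrite -ReN -ReD; exact: le_trans (norm_Re_le _) (step k).
- by rewrite -ImN -ImD; exact: le_trans (norm_Im_le _) (step k).
Qed.

(** The upper limits make the limit measurable even where the sequence
   diverges. *)
Definition climit (v : nat -> T -> R[i]) (t : T) : R[i] :=
  Complex (fine (limn_esup (fun k => (complex.Re (v k t))%:E)))
          (fine (limn_esup (fun k => (complex.Im (v k t))%:E))).

Lemma cmeas_climit v : (forall k, cmeas D (v k)) -> cmeas D (climit v).
Proof.
move=> mv; split => /=.
- apply: (measurableT_comp (fine_measurable measurableT)).
  by apply: measurable_fun_limn_esup => k; apply/measurable_EFinP; case: (mv k).
- apply: (measurableT_comp (fine_measurable measurableT)).
  by apply: measurable_fun_limn_esup => k; apply/measurable_EFinP; case: (mv k).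
Qed.

Lemma fine_limn_esup (x : nat -> R) : cvgn x ->
  x k @[k --> \oo] --> fine (limn_esup (fun k => (x k)%:E)).
Proof.
move=> cx; have xl : (x k)%:E @[k --> \oo] --> (limn x)%:E.
  by apply: cvg_EFin; [exact: nearW|exact: cx].
by rewrite (cvg_limn_einf_sup xl).2.
Qed.

Lemma cvg_nsq_climit (v : nat -> T -> R[i]) t (a : R[i]) :
  cvgn (fun k => complex.Re (v k t)) ->
  cvgn (fun k => complex.Im (v k t)) ->
  nsq (v k t - a) @[k --> \oo] --> nsq (climit v t - a).
Proof.
move=> /fine_limn_esup cR /fine_limn_esup cI.
rewrite /nsq /dotc !ReIm/=.
under eq_fun do rewrite !ReIm.
by apply: cvgD; apply: cvgM; apply: cvgD => //; exact: cvg_cst.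
Qed.

(** Fatou's lemma carries a bound on the distances to [u] over to the limit. *)
Lemma fatou_sqint (v : nat -> T -> R[i]) (u : T -> R[i]) (e : R) N :
  (forall k, sqint (v k)) -> sqint u ->
  {ae mu, forall t, D t -> cvgn (fun k => complex.Re (v k t)) /\
                           cvgn (fun k => complex.Im (v k t))} ->
  (forall k, (N <= k)%N -> nrm2 D (fun t => v k t - u t) <= e) ->
  sqint (fun t => climit v t - u t) /\ nrm2 D (fun t => climit v t - u t) <= e.
Proof.
move=> sv su aecv vu.
have mg : cmeas D (fun t => climit v t - u t).
  apply: cmeasD; first by apply: cmeas_climit => k; case: (sv k).
  by apply: cmeasN; case: su.
have svu k : sqint (fun t => v k t - u t) by exact: sqintB.
pose f k t := (nsq (v k t - u t))%:E.
have mf k : measurable_fun D (f k) by case: (svu k) => _ /integrableP[].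
have f0 k t : D t -> (0 <= f k t)%E by move=> _; rewrite lee_fin nsq_ge0.
have mG : measurable_fun D (fun t => (nsq (climit v t - u t))%:E).
  by apply/measurable_EFinP; exact: measurable_dotc.
have le_e : (\int[mu]_(t in D) (nsq (climit v t - u t))%:E <= e%:E)%E.
  rewrite (@ge0_ae_eq_integral _ _ _ mu D _ (fun t => limn_einf (f^~ t)))//.
  - apply: (le_trans (fatou mu mD mf f0)).
    rewrite limn_einf_lim; apply: lime_le; first exact: is_cvg_einfs.
    near=> n; apply: ge_ereal_inf => /=.
    exists (\int[mu]_(x in D) f (maxn N n) x)%E.
      by exists (maxn N n) => //=; exact: leq_maxr.
    rewrite -[leLHS]fineK; last first.
      by apply: integrable_fin_num => //; case: (svu (maxn N n)).
    by rewrite lee_fin; apply: vu; exact: leq_maxl.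
  - rewrite (_ : (fun t => _) = fun t => (- limn_esup (fun k => - f k t))%E).
      apply: measurableT_comp => //.
      by apply: measurable_fun_limn_esup => k; exact: measurableT_comp.
    apply/funext => t; rewrite -limn_einfN; congr limn_einf.
    by apply/funext => k; rewrite -[RHS]/(- - f k t)%E oppeK.
  - by move=> t _; rewrite lee_fin nsq_ge0.
  - move=> t Dt; rewrite limn_einf_lim; apply: lime_ge; first exact: is_cvg_einfs.
    by apply: nearW => n; apply: le_ereal_inf_tmp => _ [k _ <-]; exact: f0.
  - move: aecv; apply: filterS => t ct Dt; have [cR cI] := ct Dt.
    have cf : f k t @[k --> \oo] --> (nsq (climit v t - u t))%:E.
      by apply: cvg_EFin; [exact: nearW|exact: (@cvg_nsq_climit v t)].
    by rewrite (cvg_limn_einf_sup cf).1.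
have ge0 : (0 <= \int[mu]_(t in D) (nsq (climit v t - u t))%:E)%E.
  by apply: integral_ge0 => t _; rewrite lee_fin nsq_ge0.
have fin : (\int[mu]_(t in D) (nsq (climit v t - u t))%:E)%E \is a fin_num.
  by rewrite ge0_fin_numE// (le_lt_trans le_e)// ltry.
split; last by rewrite -lee_fin fineK.
split=> //; apply/integrableP; split=> //.
under eq_integral do rewrite gee0_abs ?lee_fin ?nsq_ge0//.
by rewrite (le_lt_trans le_e)// ltry.
Unshelve. all: by end_near. Qed.

(** A subsequence with summable steps converges almost everywhere, and Fatou's
   lemma turns this into convergence of the whole sequence in mean square. *)
Lemma L2_complete (u : nat -> T -> R[i]) : (forall n, sqint (u n)) ->
  (forall e, 0 < e -> exists N, forall n k, (N <= n)%N -> (N <= k)%N ->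
     nrm2 D (fun t => u n t - u k t) <= e) ->
  exists2 g, sqint g & forall e, 0 < e -> exists N, forall n, (N <= n)%N ->
     nrm2 D (fun t => g t - u n t) <= e.
Proof.
move=> su cau.
pose c k : R := (4 ^+ k * 2 ^+ k.+1)^-1.
have c0 k : 0 < c k by rewrite invr_gt0 mulr_gt0// exprn_gt0.
pose N k := projT1 (cid (cau _ (c0 k))).
have NP k n m : (N k <= n)%N -> (N k <= m)%N ->
    nrm2 D (fun t => u n t - u m t) <= c k.
  by rewrite /N; case: cid => M HM; exact: HM.
pose s k := (k + \sum_(j < k.+1) N j)%N.
have Ns k : (N k <= s k)%N.
  by rewrite /s big_ord_recr/= addnA leq_addl.
have sS k : (s k <= s k.+1)%N.
  by rewrite /s [in leqRHS]big_ord_recr/= leq_add// leq_addr.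
pose v k := u (s k).
have sv k : sqint (v k) by exact: su.
have aecv := @fast_cauchy_ae_cvg v sv
  (fun k => NP k _ _ (leq_trans (Ns k) (sS k)) (Ns k)).
exists (climit v).
  have [|sg _] := @fatou_sqint v (u (N 0%N)) (c 0%N) (N 0%N) sv (su _) aecv.
    move=> k Nk; apply: NP => //; apply: leq_trans (Ns 0%N) _.
    by elim: k {Nk} => // k IH; exact: leq_trans (sS k).
  have -> : climit v = fun t => (climit v t - u (N 0%N) t) + u (N 0%N) t.
    by apply/funext => t; rewrite subrK.
  exact: sqintD.
move=> e e0; have [M HM] := cau e e0; exists M => n Mn.
apply: (proj2 (@fatou_sqint v (u n) e M sv (su n) aecv _)) => k Mk.
by apply: HM => //; apply: leq_trans Mk _; exact: leq_addr.
Qed.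

End riesz_fischer.

(** * Extremal points of closed convex sets *)

Section convex_sets.
Context d (T : measurableType d) (R : realType).
Variables (mu : {measure set T -> \bar R}) (D : set T).
Hypothesis mD : measurable D.
Implicit Types (u v w g k : T -> R[i]) (A : set T) (C : set (T -> R[i])).
Local Notation sqint := (sqint mu D).
Local Notation ip := (ip mu D).
Local Notation nrm2 := (nrm2 mu).

Definition midpoint u v := fun t => 2^-1 * (u t + v t).

(** Midpoints suffice for convexity here, since the parallelogram law only
   involves midpoints. *)
Definition convex_closed C := [/\ forall u, C u -> sqint u,
  forall u v, C u -> C v -> C (midpoint u v) &
  forall u, sqint u -> (forall e, 0 < e ->
    exists2 v, C v & nrm2 D (fun t => u t - v t) <= e) -> C u].

Lemma half_complex : 2^-1 = (2^-1 : R)%:C%C :> R[i].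
Proof. by rewrite -[X in X^-1](rmorph_nat (real_complex R)) fmorphV. Qed.

Lemma nsq_midpoint (a b c : R[i]) :
  4 * nsq (2^-1 * (a + b) - c) + nsq (a - b) = 2 * nsq (a - c) + 2 * nsq (b - c).
Proof. by rewrite half_complex /nsq /dotc !ReIm/=; field. Qed.

Lemma nrm2_comb A u v (a b : R) : measurable A -> A `<=` D ->
  sqint u -> sqint v -> a * nrm2 A u + b * nrm2 A v =
  \int[mu]_(t in A) (a * nsq (u t) + b * nsq (v t)).
Proof.
move=> mA AD su sv.
have iu := nsq_integrable mD mA AD su; have iv := nsq_integrable mD mA AD sv.
rewrite RintegralD//; last 2 first.
- exact: (integrableZl mA a iu).
- exact: (integrableZl mA b iv).
by rewrite !RintegralZl.
Qed.

Lemma parallelogram A u v k : measurable A -> A `<=` D ->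
  sqint u -> sqint v -> sqint k ->
  4 * nrm2 A (fun t => midpoint u v t - k t) + nrm2 A (fun t => u t - v t) =
  2 * (nrm2 A (fun t => u t - k t) + nrm2 A (fun t => v t - k t)).
Proof.
move=> mA AD su sv sk; have sm := sqint_mid mD su sv.
rewrite mulrDr -[X in _ + X = _]mul1r !nrm2_comb//; try exact: sqintB.
by apply: eq_Rintegral => t _; rewrite mul1r nsq_midpoint.
Qed.

Lemma nrm2_midpoint_le A u v k (c : R) : measurable A -> A `<=` D ->
  sqint u -> sqint v -> sqint k -> nrm2 A (fun t => u t - k t) <= c ->
  nrm2 A (fun t => v t - k t) <= c -> nrm2 A (fun t => midpoint u v t - k t) <= c.
Proof.
move=> mA AD su sv sk uc vc; have sm := sqint_mid mD su sv.
have : nrm2 A (fun t => midpoint u v t - k t) <=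
    2^-1 * nrm2 A (fun t => u t - k t) + 2^-1 * nrm2 A (fun t => v t - k t).
  apply: (nrm2_le mD) => //; try exact: sqintB.
  move=> t _; have := nsq_midpoint (u t) (v t) (k t).
  have := nsq_ge0 (u t - v t); rewrite /midpoint; lra.
lra.
Qed.

(** Minimizes the distance to [k] on [A], where a minimizing sequence need not
   converge, by using the distance to [k] on the whole domain as the second
   criterion. *)
Lemma L2_lexicographic_min C A k (Bd : R) : measurable A -> A `<=` D ->
  sqint k -> convex_closed C ->
  (forall e, 0 < e -> exists g, [/\ C g, forall g', C g' ->
     nrm2 A (fun t => g t - k t) <= nrm2 A (fun t => g' t - k t) + e &
     nrm2 D (fun t => g t - k t) <= Bd]) ->
  exists g, [/\ C g, forall g', C g' ->
    nrm2 A (fun t => g t - k t) <= nrm2 A (fun t => g' t - k t) &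
    forall g', C g' ->
    nrm2 A (fun t => g' t - k t) <= nrm2 A (fun t => g t - k t) ->
    nrm2 D (fun t => g t - k t) <= nrm2 D (fun t => g' t - k t)].
Proof.
move=> mA AD sk [sC midC clC] near_min.
apply: (@lexicographic_min R _ C midpoint
  (fun u v => nrm2 D (fun t => u t - v t))
  (fun u => nrm2 A (fun t => u t - k t)) (fun u => nrm2 D (fun t => u t - k t))
  Bd) => //.
- by move=> u Cu; exact: nrm2_ge0.
- by move=> u Cu; exact: nrm2_ge0.
- by move=> u v c /sC su /sC sv; exact: nrm2_midpoint_le.
- by move=> u v /sC su /sC sv; rewrite parallelogram.
- move=> u Cu cau; have su n := sC _ (Cu n).
  have [g sg gu] := L2_complete mD su cau.
  exists g.
    apply: clC => // e e0; have [N HN] := gu _ e0.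
    by exists (u N) => //; exact: HN.
  move=> e e0.
  have [dA dA0 HA] := nrm2_lsc mD mA AD sg sk e0.
  have [dD dD0 HD] := nrm2_lsc mD mD (@subset_refl _ D) sg sk e0.
  have [|N HN] := gu (Num.min dA dD); first by rewrite lt_min dA0.
  exists N => n Nn; have := HN _ Nn; rewrite le_min => /andP[h1 h2].
  by split; [exact: HA|exact: HD].
Qed.

(** The special case where the first criterion is void. *)
Lemma nearest_point C k : sqint k -> convex_closed C -> (exists g, C g) ->
  exists2 g, C g & forall g', C g' ->
    nrm2 D (fun t => g t - k t) <= nrm2 D (fun t => g' t - k t).
Proof.
move=> sk cC [g0 Cg0].
have z u : nrm2 set0 u = 0 by exact: Rintegral_set0.
have [|e e0|g [Cg _ gmin]] :=
  @L2_lexicographic_min C set0 k (nrm2 D (fun t => g0 t - k t)) measurable0 _ sk cC.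
- exact: sub0set.
- by exists g0; split=> // g' _; rewrite !z add0r ltW.
- by exists g => // g' Cg'; apply: gmin => //; rewrite !z.
Qed.

Definition L2closure C : set (T -> R[i]) := [set u | sqint u /\
  forall e, 0 < e -> exists2 v, C v & nrm2 D (fun t => u t - v t) <= e].

Lemma nrm2_sub_le u v w : sqint u -> sqint v -> sqint w ->
  nrm2 D (fun t => u t - w t) <=
  2 * nrm2 D (fun t => u t - v t) + 2 * nrm2 D (fun t => v t - w t).
Proof.
move=> su sv sw; apply: (nrm2_le mD) => //; try exact: sqintB.
move=> t _; rewrite -mulrDr.
have -> : u t - w t = (u t - v t) + (v t - w t) by ring.
exact: nsqD_le.
Qed.

Lemma sub_L2closure C : (forall u, C u -> sqint u) -> C `<=` L2closure C.
Proof.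
move=> sC u Cu; split; first exact: sC.
move=> e e0; exists u => //; rewrite /nrm2 (@eq_Rintegral _ _ _ mu D (fun=> 0)).
  by rewrite Rintegral_cst// mul0r ltW.
by move=> t _; rewrite subrr nsq0.
Qed.

Lemma convex_closed_closure C : (forall u, C u -> sqint u) ->
  (forall u v, C u -> C v -> C (midpoint u v)) -> convex_closed (L2closure C).
Proof.
move=> sC midC; split; first by move=> u [].
- move=> u v [su cu] [sv cv]; split; first exact: sqint_mid.
  move=> e e0; have [u' Cu' uu'] := cu _ e0; have [v' Cv' vv'] := cv _ e0.
  exists (midpoint u' v'); first exact: midC.
  have su' := sC _ Cu'; have sv' := sC _ Cv'.
  have : nrm2 D (fun t => midpoint u v t - midpoint u' v' t) <=
      2^-1 * nrm2 D (fun t => u t - u' t) + 2^-1 * nrm2 D (fun t => v t - v' t).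
    apply: (nrm2_le mD) => //; try by apply: sqintB => //; exact: sqint_mid.
    move=> t _; have := nsq_midpoint (u t - u' t) (v t - v' t) 0.
    rewrite /midpoint !subr0.
    have -> : 2^-1 * (u t - u' t + (v t - v' t)) =
              2^-1 * (u t + v t) - 2^-1 * (u' t + v' t) by ring.
    have := nsq_ge0 (u t - u' t - (v t - v' t)); lra.
  lra.
- move=> u su cu; split=> // e e0; have e4 : 0 < e / 4 by rewrite divr_gt0.
  have [v [sv cv] uv] := cu _ e4; have [w Cw vw] := cv _ e4.
  by exists w => //; have := nrm2_sub_le su sv (sC _ Cw); lra.
Qed.

End convex_sets.

(** * Trigonometric polynomials approximating arcs *)

Section fourier_uniqueness.
Variable R : realType.
Local Notation leb := (@completed_lebesgue_measure R).
Local Notation lebT := (caratheodory_type (wlength (@idfun R))^*%mu).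
Implicit Types (phi psi s : R -> R) (c : R).

Definition period : set R := [set t | 0 <= t < 2 * pi].

Lemma completed_measurable (A : set R) :
  measurable (A : set (measurableTypeR R)) -> measurable (A : set lebT).
Proof. by move=> mA; exact: sub_caratheodory. Qed.

Lemma completed_measurable_fun (D : set R) (f : R -> R) :
  measurable (D : set lebT) ->
  measurable_fun [set: measurableTypeR R] (f : measurableTypeR R -> R) ->
  measurable_fun (D : set lebT) (f : lebT -> R).
Proof.
move=> mD mf _ Y mY; apply: measurableI => //; apply: completed_measurable.
by rewrite -[_ @^-1` _]setTI; exact: mf.
Qed.

Lemma continuous_completed_measurable (D : set R) (f : R -> R) :
  measurable (D : set lebT) -> continuous f ->
  measurable_fun (D : set lebT) (f : lebT -> R).
Proof.
move=> mD cf; apply: completed_measurable_fun => //.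
exact: continuous_measurable_fun.
Qed.

Lemma periodE : period = [set` `[0, 2 * pi[].
Proof. by apply/seteqP; split=> t /=; rewrite in_itv. Qed.

Lemma measurable_period : measurable (period : set lebT).
Proof. by rewrite periodE; apply: completed_measurable; exact: measurable_itv. Qed.
Let mP := measurable_period.

Lemma completed_measure_period : leb period = (2 * pi)%:E.
Proof.
have -> : leb period = @lebesgue_measure R [set` `[0, 2 * pi[] by rewrite periodE.
by rewrite lebesgue_measure_itv/= lte_fin mulr_gt0 ?pi_gt0// -EFinB subr0.
Qed.

Lemma completed_measure_set1 c : leb [set c] = 0%E.
Proof. exact: lebesgue_measure_set1. Qed.

Lemma integrable_cst_period c : leb.-integrable period (EFin \o (fun=> c)).
Proof.
apply/integrableP; split; first exact: measurable_cst.
have -> : (\int[leb]_(t in period) `|(EFin \o (fun=> c)) t| = `|c|%:E * leb period)%E.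
  exact: integral_cst.
by rewrite completed_measure_period -EFinM ltry.
Qed.

Definition null_against phi p :=
  leb.-integrable period (EFin \o (fun t => phi t * p t)) /\
  \int[leb]_(t in period) (phi t * p t) = 0.

Lemma null_againstD phi p q : null_against phi p -> null_against phi q ->
  null_against phi (fun t => p t + q t).
Proof.
move=> [ip p0] [iq q0]; rewrite /null_against.
under [X in _ /\ X = 0]eq_Rintegral do rewrite mulrDr.
rewrite RintegralD// p0 q0 addr0; split=> //.
rewrite (_ : EFin \o _ = EFin \o (fun t => phi t * p t + phi t * q t)).
  exact: integrableDR.
by apply/funext => t /=; rewrite mulrDr.
Qed.

Lemma null_againstZ phi c p : null_against phi p ->
  null_against phi (fun t => c * p t).
Proof.
move=> [ip p0]; rewrite /null_against.
under [X in _ /\ X = 0]eq_Rintegral do rewrite mulrCA.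
rewrite RintegralZl// p0 mulr0; split=> //.
rewrite (_ : EFin \o _ = EFin \o (fun t => c * (phi t * p t))).
  exact: integrableZR.
by apply/funext => t /=; rewrite mulrCA.
Qed.

Lemma eq_null_against phi p psi q : (forall t, phi t * p t = psi t * q t) ->
  null_against phi p -> null_against psi q.
Proof.
rewrite /null_against => e.
by rewrite (_ : (fun t => phi t * p t) = (fun t => psi t * q t)) //; apply/funext.
Qed.

Definition trig_null phi := forall n : int,
  null_against phi (fun t => cos (n%:~R * t)) /\
  null_against phi (fun t => sin (n%:~R * t)).

(** Trigonometric polynomials are handled through this property: it is stable
   under sums and products, and holds for [cos] and [sin] because multiplying by
   them shifts frequencies by 1. *)
Definition multiplier s := forall phi, trig_null phi ->
  trig_null (fun t => phi t * s t).

Lemma multiplierD s s' : multiplier s -> multiplier s' ->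
  multiplier (fun t => s t + s' t).
Proof.
move=> ms ms' phi pn n.
have [a1 a2] := ms _ pn n; have [b1 b2] := ms' _ pn n.
split.
- have a1' : null_against phi (fun t => s t * cos (n%:~R * t)).
    by apply: eq_null_against a1 => t; rewrite mulrA.
  have b1' : null_against phi (fun t => s' t * cos (n%:~R * t)).
    by apply: eq_null_against b1 => t; rewrite mulrA.
  by apply: eq_null_against (null_againstD a1' b1') => t; ring.
- have a1' : null_against phi (fun t => s t * sin (n%:~R * t)).
    by apply: eq_null_against a2 => t; rewrite mulrA.
  have b1' : null_against phi (fun t => s' t * sin (n%:~R * t)).
    by apply: eq_null_against b2 => t; rewrite mulrA.
  by apply: eq_null_against (null_againstD a1' b1') => t; ring.
Qed.

Lemma multiplierM s s' : multiplier s -> multiplier s' ->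
  multiplier (fun t => s t * s' t).
Proof.
move=> ms ms' phi pn n; have [a b] := ms' _ (ms _ pn) n.
by split; [apply: eq_null_against a|apply: eq_null_against b] => t; ring.
Qed.

Lemma multiplier_cst c : multiplier (fun=> c).
Proof.
move=> phi pn n; have [a b] := pn n; split.
  by apply: eq_null_against (null_againstZ c a) => t; ring.
by apply: eq_null_against (null_againstZ c b) => t; ring.
Qed.

Lemma multiplierX s m : multiplier s -> multiplier (fun t => s t ^+ m).
Proof.
move=> ms; elim: m => [|m IH]; first exact: multiplier_cst.
rewrite (_ : (fun t => _) = fun t => s t * s t ^+ m); first exact: multiplierM.
by apply/funext => t; rewrite exprS.
Qed.

Let shiftE (n : int) (t : R) : ((n + 1)%:~R * t = n%:~R * t + t) *
  ((n - 1)%:~R * t = n%:~R * t - t).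
Proof. by rewrite !intrD mulrDl mul1r intrN mulrBl mul1r. Qed.

Lemma multiplier_cos : multiplier cos.
Proof.
move=> phi pn n; have [a b] := pn (n + 1); have [a' b'] := pn (n - 1); split.
- apply: eq_null_against (null_againstZ 2^-1 (null_againstD a a')) => t.
  by rewrite !shiftE cosD cosB; field.
- apply: eq_null_against (null_againstZ 2^-1 (null_againstD b b')) => t.
  by rewrite !shiftE sinD sinB; field.
Qed.

Lemma multiplier_sin : multiplier sin.
Proof.
move=> phi pn n; have [a b] := pn (n + 1); have [a' b'] := pn (n - 1); split.
- apply: eq_null_against (null_againstD (null_againstZ 2^-1 b)
    (null_againstZ (- 2^-1) b')) => t.
  by rewrite !shiftE sinD sinB; field.
- apply: eq_null_against (null_againstD (null_againstZ (- 2^-1) a)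
    (null_againstZ 2^-1 a')) => t.
  by rewrite !shiftE cosD cosB; field.
Qed.

Lemma bernoulli_ineq (x : R) m : 0 <= x <= 1 -> 1 - m%:R * x <= (1 - x) ^+ m.
Proof.
move=> /andP[x0 x1]; elim: m => [|m IH]; first by rewrite mul0r subr0 expr0.
have : (1 - x) * (1 - m%:R * x) <= (1 - x) * (1 - x) ^+ m.
  by rewrite ler_wpM2l// subr_ge0.
rewrite -exprS; apply: le_trans; rewrite -natr1.
have : 0 <= m%:R * x * x by rewrite !mulr_ge0.
lra.
Qed.

Lemma bernoulli_inv_ineq (x : R) m : 0 <= x <= 1 ->
  (1 - x) ^+ m * (1 + m%:R * x) <= 1.
Proof.
move=> /andP[x0 x1].
have H : 1 + m%:R * x <= (1 + x) ^+ m.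
  elim: m => [|m IH]; first by rewrite mul0r addr0 expr0.
  have : (1 + x) * (1 + m%:R * x) <= (1 + x) * (1 + x) ^+ m.
    by rewrite ler_wpM2l// addr_ge0.
  rewrite -exprS; apply: le_trans; rewrite -natr1.
  have : 0 <= m%:R * x * x by rewrite !mulr_ge0.
  lra.
apply: (@le_trans _ _ ((1 - x) ^+ m * (1 + x) ^+ m)).
  by rewrite ler_wpM2l// exprn_ge0// subr_ge0.
rewrite -exprMn exprn_ile1//; first by rewrite mulr_ge0; lra.
by have : 0 <= x * x; [exact: mulr_ge0|lra].
Qed.

(** The polynomials that separate [y < 1/2] from [y > 1/2] on [[0, 1]]: the
   exponent [2 ^ n] beats [(1 / y) ^ n] exactly when [y > 1/2]. *)
Definition step_poly n (y : R) : R := (1 - y ^+ n) ^+ (2 ^ n).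

Lemma step_poly_itv n y : 0 <= y <= 1 -> 0 <= step_poly n y <= 1.
Proof.
move=> /andP[y0 y1]; have yn : 0 <= y ^+ n <= 1.
  by rewrite exprn_ge0//= exprn_ile1.
by move: yn => /andP[? ?]; rewrite exprn_ge0 ?exprn_ile1//; lra.
Qed.

Lemma cvg_step_poly_left y : 0 <= y < 2^-1 ->
  step_poly n y @[n --> \oo] --> (1 : R).
Proof.
move=> /andP[y0 y2].
have yi n : 0 <= y ^+ n <= 1 by rewrite exprn_ge0//= exprn_ile1//; lra.
apply: (@squeeze_cvgr _ _ _ _ (fun n => 1 - (2 * y) ^+ n) (fun=> 1)).
- apply: nearW => n; have := @step_poly_itv n y.
  have -> : 0 <= y <= 1 by apply/andP; split; lra.
  move=> /(_ isT) /andP[_ ->]; rewrite andbT exprMn.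
  by have := bernoulli_ineq (2 ^ n) (yi n); rewrite natrX.
- rewrite -[X in _ --> X]subr0; apply: cvgB; first exact: cvg_cst.
  by apply: cvg_expr; rewrite ger0_norm; lra.
- exact: cvg_cst.
Qed.

Lemma cvg_step_poly_right y : 2^-1 < y <= 1 ->
  step_poly n y @[n --> \oo] --> (0 : R).
Proof.
move=> /andP[y2 y1].
have y0 : 0 <= y by lra.
have yi n : 0 <= y ^+ n <= 1 by rewrite exprn_ge0//= exprn_ile1.
apply: (@squeeze_cvgr _ _ _ _ (fun=> 0) (fun n => (2 * y)^-1 ^+ n)).
- apply: nearW => n; have := @step_poly_itv n y.
  rewrite y0 y1 => /(_ isT) /andP[-> _] /=.
  have := bernoulli_inv_ineq (2 ^ n) (yi n); rewrite natrX -exprMn => H.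
  have p : 0 < (2 * y) ^+ n by rewrite exprn_gt0//; lra.
  rewrite exprVn -[leRHS]mul1r ler_pdivlMr//; apply: le_trans H.
  by rewrite ler_wpM2l ?lerDr// exprn_ge0// subr_ge0; have /andP[] := yi n.
- exact: cvg_cst.
- apply: cvg_expr; rewrite ger0_norm ?invr_ge0; last by lra.
  by rewrite invf_lt1; lra.
Qed.

End fourier_uniqueness.

(** * Uniqueness of Fourier coefficients *)

Section fourier_uniqueness_end.
Variable R : realType.
Local Notation leb := (@completed_lebesgue_measure R).
Local Notation lebT := (caratheodory_type (wlength (@idfun R))^*%mu).
Local Notation period := (@period R).
Let mP := @measurable_period R.
Implicit Types (phi : R -> R) (c : R).

Lemma trig_null_integrable phi : trig_null phi ->
  leb.-integrable period (EFin \o phi).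
Proof.
move=> /(_ 0) [[+ _] _]; congr (_.-integrable _ _).
by apply/funext => t /=; rewrite mul0r cos0 mulr1.
Qed.

Lemma trig_null_int phi : trig_null phi -> \int[leb]_(t in period) phi t = 0.
Proof.
move=> /(_ 0) [[_ <-] _]; apply: eq_Rintegral => t _.
by rewrite mul0r cos0 mulr1.
Qed.

(** The trigonometric polynomial [1/2 + (cos (c / 2) - cos (t - c / 2)) / 4] of
   degree 1, factored to show its position relative to 1/2: for [t] and [c]
   inside the period, [sin (t / 2)] is positive and [sin ((c - t) / 2)] has the
   sign of [c - t]. *)
Definition arc_level c (t : R) : R := 2^-1 - 2^-1 * (sin (t / 2) * sin ((c - t) / 2)).

Lemma multiplier_arc_level c : multiplier (arc_level c).
Proof.
have -> : arc_level c = fun t => (2^-1 + 4^-1 * cos (c / 2)) +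
    (- 4^-1 * cos (c / 2) * cos t + - 4^-1 * sin (c / 2) * sin t).
  apply/funext => t; rewrite /arc_level.
  have -> : sin (t / 2) * sin ((c - t) / 2) =
      2^-1 * (cos (t / 2 - (c - t) / 2) - cos (t / 2 + (c - t) / 2)).
    by rewrite cosB cosD; field.
  have -> : t / 2 - (c - t) / 2 = t - c / 2 by field.
  have -> : t / 2 + (c - t) / 2 = c / 2 by field.
  by rewrite cosB; field.
apply: multiplierD; first exact: multiplier_cst.
by apply: multiplierD; apply: multiplierM;
  [exact: multiplier_cst|exact: multiplier_cos
  |exact: multiplier_cst|exact: multiplier_sin].
Qed.

Lemma multiplier_step_poly c n : multiplier (fun t => step_poly n (arc_level c t)).
Proof.
rewrite /step_poly; apply: multiplierX.
have -> : (fun t => 1 - arc_level c t ^+ n) =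
    fun t => 1 + (-1) * arc_level c t ^+ n by apply/funext => t; ring.
apply: multiplierD; first exact: multiplier_cst.
apply: multiplierM; first exact: multiplier_cst.
exact/multiplierX/multiplier_arc_level.
Qed.

Lemma arc_level_itv c t : 0 <= arc_level c t <= 1.
Proof.
rewrite /arc_level; set x := _ * sin ((c - t) / 2).
have : `|x| <= 1 by rewrite normrM mulr_ile1// sin_max.
by rewrite ler_norml => /andP[? ?]; apply/andP; split; lra.
Qed.

Lemma continuous_arc_level c : continuous (arc_level c).
Proof.
move=> t; apply: cvgB; first exact: cvg_cst.
apply: cvgM; first exact: cvg_cst.
have h (a b : R) : (a + b * x) @[x --> t] --> a + b * t.
  apply: cvgD; first exact: cvg_cst.
  by apply: cvgM; [exact: cvg_cst|exact: cvg_id].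
have -> : (fun x => sin (x / 2) * sin ((c - x) / 2)) =
    (fun x => sin (0 + 2^-1 * x) * sin (c / 2 + - 2^-1 * x)).
  by apply/funext => x; congr (sin _ * sin _); field.
have -> : sin (t / 2) * sin ((c - t) / 2) =
    sin (0 + 2^-1 * t) * sin (c / 2 + - 2^-1 * t).
  by congr (sin _ * sin _); field.
by apply: cvgM; apply: (cvg_comp _ sin (h _ _)); exact: continuous_sin.
Qed.

Lemma cvg_step_arc c t : 0 < c < 2 * pi -> 0 < t < 2 * pi -> t != c ->
  step_poly n (arc_level c t) @[n --> \oo] --> (\1_[set` `]-oo, c[] t : R).
Proof.
move=> /andP[c0 cp] /andP[t0 tp] tc; rewrite indicE mem_setE in_itv/=.
have s1 : 0 < sin (t / 2) by apply: sin_gt0_pi; apply/andP; split; lra.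
have := arc_level_itv c t.
have [tlc|clt|tec] := ltgtP t c; last by rewrite tec eqxx in tc.
- move=> /andP[? ?]; apply: cvg_step_poly_left; apply/andP; split=> //.
  have s2 : 0 < sin ((c - t) / 2) by apply: sin_gt0_pi; apply/andP; split; lra.
  have := mulr_gt0 s1 s2; rewrite /arc_level; lra.
- move=> /andP[? ?]; apply: cvg_step_poly_right; apply/andP; split=> //.
  have s2 : 0 < sin ((t - c) / 2) by apply: sin_gt0_pi; apply/andP; split; lra.
  have := mulr_gt0 s1 s2; rewrite /arc_level.
  have -> : (c - t) / 2 = - ((t - c) / 2) by field.
  rewrite sinN mulrN; lra.
Qed.

(** By dominated convergence along [step_poly n (arc_level c t)]. *)
Lemma trig_null_ray phi c : trig_null phi ->
  (\int[leb]_(t in period `&` [set` `]-oo, c[]) (phi t)%:E = 0)%E.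
Proof.
move=> np; have iphi := trig_null_integrable np.
have i0 : (\int[leb]_(t in period) (phi t)%:E = 0)%E.
  rewrite -[LHS]fineK; first by congr EFin; exact: trig_null_int.
  exact: integrable_fin_num.
have [c0|c0] := leP c 0.
  rewrite (_ : _ `&` _ = set0) ?integral_set0//.
  by apply/seteqP; split=> // t [/andP[t0 _]] /=; rewrite in_itv/=; lra.
have [cp|cp] := leP (2 * pi) c.
  rewrite (_ : _ `&` _ = period)//.
  apply/seteqP; split=> [t []//|t tP]; split=> //.
  by move: tP => /andP[_ t2] /=; rewrite in_itv/=; lra.
have c02 : 0 < c < 2 * pi by rewrite c0.
have mray : measurable ([set` `]-oo, c[] : set lebT).
  by apply: completed_measurable; exact: measurable_itv.
have mphi : measurable_fun (period : set lebT) phi.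
  by case/integrableP: iphi => /measurable_EFinP.
have mstep n : measurable_fun (period : set lebT)
    (fun t => step_poly n (arc_level c t)).
  apply: measurable_funX; apply: (measurable_funB (measurable_cst _)).
  apply: measurable_funX.
  exact: (continuous_completed_measurable mP (@continuous_arc_level c)).
pose f_ n t := (phi t * step_poly n (arc_level c t))%:E.
pose f t := (phi t * \1_[set` `]-oo, c[] t)%:E.
have [] := @dominated_convergence _ _ _ leb period mP f_ f
    (fun t => `|(phi t)%:E|%E).
- by move=> n; apply/measurable_EFinP; exact: measurable_funM.
- by apply/measurable_EFinP; apply: measurable_funM => //; exact: measurable_indic.
- (* At 0 and at [c] the level is 1/2, where the limit is neither 0 nor 1. *)
  exists ([set 0 : R] `|` [set c]); split.
  + by apply: measurableU; apply: completed_measurable; exact: measurable_set1.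
  + apply/eqP; rewrite -measure_le0.
    apply: (le_trans (measureU2 _ _ _)).
    * by apply: completed_measurable; exact: measurable_set1.
    * by apply: completed_measurable; exact: measurable_set1.
    * by rewrite [X in (X + _)%E](completed_measure_set1 0)
        [X in (_ + X)%E](completed_measure_set1 c) adde0.
  + move=> t /= Hn; apply: contrapT => /not_orP[t0 tc]; apply: Hn => /andP[t1 t2].
    apply: cvg_EFin; first exact: nearW.
    apply: cvgM; first exact: cvg_cst.
    apply: cvg_step_arc => //; last by apply/eqP.
    by rewrite t2 andbT lt_neqAle t1 andbT; apply/eqP => /esym.
- exact: integrable_abse.
- apply: aeW => t n _; rewrite lee_fin normrM ler_piMr//.
  have /andP[a b] := step_poly_itv n (arc_level_itv c t).
  by rewrite ger0_norm.
move=> _ _; have -> : (fun n => \int[leb]_(t in period) f_ n t)%E = fun=> 0%E.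
  apply/funext => n; have ns := multiplier_step_poly c n np.
  rewrite -[LHS]fineK; first by congr EFin; exact: trig_null_int ns.
  exact/integrable_fin_num/(trig_null_integrable ns).
move=> /(cvg_unique _ (cvg_cst _)) H.
rewrite integral_mkcondr {}H//; apply: eq_integral => t _.
rewrite /f patchE indicE; case: ifPn => _; by rewrite ?mulr1// mulr0.
Qed.

Lemma trig_null_borel phi (A : set R) : trig_null phi ->
  measurable (A : set (measurableTypeR R)) ->
  (\int[leb]_(t in period `&` A) (phi t)%:E = 0)%E.
Proof.
move=> np mA; have iphi := trig_null_integrable np.
have i0 : (\int[leb]_(t in period) (phi t)%:E = 0)%E.
  rewrite -[LHS]fineK; first by congr EFin; exact: trig_null_int.
  exact: integrable_fin_num.
have mE := RGenInftyO.measurableE R.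
apply: (@dynkin_induction _ (measurableTypeR R) (@RGenInftyO.G R)
  (fun A => \int[leb]_(t in period `&` A) (phi t)%:E = 0)%E) => //.
- move=> _ _ [a ->] [b ->]; exists (Num.min a b).
  by apply/seteqP; split=> t /=; rewrite !in_itv/= lt_min => /andP.
- by rewrite setIT.
- by move=> _ [a ->]; exact: trig_null_ray.
- move=> S mS S0; have mS' := completed_measurable mS.
  have mPS := measurableI _ _ mP mS'.
  have mPC := measurableI _ _ mP (measurableC mS').
  have PE : (period `&` S) `|` (period `&` ~` S) = period.
    by rewrite -setIUr setUv setIT.
  have mphi : measurable_fun ((period `&` S) `|` (period `&` ~` S) : set lebT)
      (EFin \o phi).
    by rewrite PE; have /integrableP[] := iphi.
  have dSC : disj_set (period `&` S) (period `&` ~` S).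
    by apply/disj_setPS => t [[_ ?] []].
  by have := integral_setU leb mPS mPC mphi dSC; rewrite PE i0 S0 add0e.
- move=> F mF tF F0; rewrite setI_bigcupr integral_bigcup.
  + by rewrite eseries0.
  + by apply: trivIset_setIl.
  + by move=> k; apply: measurableI => //; exact: completed_measurable.
  + apply: integrableS iphi => //.
      by apply: bigcupT_measurable => k; apply: measurableI => //;
        exact: completed_measurable.
    by move=> t [k _ []].
- exact: (@eq_ind (set (set R)) _ (fun G => G A) mA _ mE).
Qed.

(** The integral of [phi] vanishes over every measurable set, because such a set
   is Borel up to a null set. *)
Lemma trig_null_ae0 phi : trig_null phi ->
  {ae leb, forall t, period t -> phi t = 0}.
Proof.
move=> np; have iphi := trig_null_integrable np.
have := @integral_ae_eq _ _ _ leb period mP (cst 0%E) (EFin \o phi) iphi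
  (measurable_cst _).
case=> [E EP mE|N [mN N0 sN]].
  rewrite integral_cst// mul0e.
  have : (completed_algebra_gen (@lebesgue_measure R)) E.
    by rewrite -g_sigma_completed_algebra_genE completed_caratheodory_measurable.
  move=> [A mA [N' [B [mB B0 N'B]] AE]].
  have mB' := completed_measurable mB.
  have iE : leb.-integrable E (EFin \o phi) by exact: integrableS iphi.
  rewrite (negligible_integral mB' mE iE B0).
  have -> : E `\` B = period `&` (A `\` B).
    apply/seteqP; split=> t; rewrite -AE.
      move=> [[At|/N'B//] Bt]; split=> //; apply: EP; rewrite -AE; by left.
    by move=> [_ [At Bt]]; split=> //; left.
  by apply: trig_null_borel => //; exact: measurableD.
exists N; split=> // t /= Ht; apply: sN => /= Hp; apply: Ht => Pt.
by have [] := Hp Pt.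
Qed.

End fourier_uniqueness_end.

(** * Orthogonality of the characters *)

Section characters.
Variable R : realType.
Local Notation leb := (@completed_lebesgue_measure R).
Local Notation lebT := (caratheodory_type (wlength (@idfun R))^*%mu).
Local Notation period := (@period R).
Let mP := @measurable_period R.

Lemma bounded_integrable_period (f : R -> R) (K : R) : continuous f ->
  (forall t, `|f t| <= K) -> leb.-integrable period (EFin \o f).
Proof.
move=> cf fK; apply: (@le_integrableR _ _ _ leb period mP _ (fun=> K)) => //.
  exact: continuous_completed_measurable.
exact: integrable_cst_period.
Qed.

(** The two measures agree on Borel sets: one is the image of the other under
   the identity. *)
Lemma completed_integral (f : R -> R) : continuous f ->
  leb.-integrable period (EFin \o f) ->
  (\int[leb]_(t in period) (f t)%:E =
   \int[@lebesgue_measure R]_(t in [set` `[0%R, (2 * pi)%R[]) (f t)%:E)%E.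
Proof.
move=> cf iF.
have mid : measurable_fun [set: lebT] (idfun : lebT -> measurableTypeR R).
  by move=> _ Y mY; rewrite setTI; exact: completed_measurable.
have mf : measurable_fun [set: measurableTypeR R] (EFin \o f).
  by apply/measurable_EFinP; exact: continuous_measurable_fun.
have mI : measurable ([set` `[0%R, (2 * pi)%R[] : set (measurableTypeR R)).
  exact: measurable_itv.
have := @integral_pushforward _ _ _ _ _ _ mid leb _ _ mf _ mI.
rewrite -periodE => /(_ iF) <-.
by apply: eq_measure_integral.
Qed.

Lemma integral_period_FTC (f F : R -> R) (K : R) : continuous f ->
  (forall t, `|f t| <= K) -> (forall t : R, is_derive t 1 F (f t)) ->
  \int[leb]_(t in period) f t = F (2 * pi) - F 0.
Proof.
move=> cf fK dF; have iF := bounded_integrable_period cf fK.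
have p0 : 0 < 2 * pi :> R by rewrite mulr_gt0// pi_gt0.
have derF t : derivable F t 1 by have [] := dF t.
have cF : continuous F.
  by move=> t; apply/differentiable_continuous/derivable1_diffP.
have H : (\int[lebesgue_measure]_(x in `[0%R, (2 * pi)%R]) (f x)%:E =
    (F (2 * pi))%:E - (F 0)%:E)%E.
  apply: continuous_FTC2 => //.
  - exact: continuous_subspaceT.
  - split=> [t _|//|]; first exact: derF.
      by apply: cvg_at_right_filter; exact: cF.
    by apply: cvg_at_left_filter; exact: cF.
  - by move=> t _; rewrite derive1E; have [_ ->] := dF t.
rewrite /Rintegral completed_integral// -integral_itv_bndo_bndc in H *; last first.
  by apply/measurable_EFinP/measurable_funTS; exact: continuous_measurable_fun.
by rewrite H.
Qed.

Lemma sincos_int_period (n : int) :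
  sin (n%:~R * (2 * pi)) = 0 :> R /\ cos (n%:~R * (2 * pi)) = 1 :> R.
Proof.
have H (m : nat) : sin (m%:R * (2 * pi)) = 0 :> R /\ cos (m%:R * (2 * pi)) = 1 :> R.
  have -> : m%:R * (2 * pi) = 0 + pi *+ 2 *+ m :> R.
    by rewrite add0r -[RHS]mulr_natl; congr (_ * _); rewrite mulr_natl.
  by rewrite (periodicn (@sinD2pi R)) (periodicn (@cosD2pi R)) sin0 cos0.
case: (intP n) => [|m|m].
- exact: (H 0%N).
- exact: (H m.+1).
- by rewrite mulNr sinN cosN (H m.+1).1 (H m.+1).2 oppr0.
Qed.

Lemma continuous_scale (a : R) (f : R -> R) : continuous f ->
  continuous (fun t => f (a * t)).
Proof.
move=> cf t; apply: (cvg_comp (fun x => a * x) f); last exact: cf.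
by apply: cvgM; [exact: cvg_cst|exact: cvg_id].
Qed.

Lemma integral_char (n : int) : n != 0 ->
  \int[leb]_(t in period) cos (n%:~R * t) = 0 /\
  \int[leb]_(t in period) sin (n%:~R * t) = 0.
Proof.
move=> n0; set a : R := n%:~R.
have a0 : a != 0 by rewrite intr_eq0.
have dL (t : R) : is_derive t 1 (fun x : R => a * x) a.
  by apply: is_derive_eq; rewrite /GRing.scale/= mulr1.
have dS (t : R) : is_derive t 1 (fun x => a^-1 * sin (a * x)) (cos (a * t)).
  have ? := dL t; apply: is_derive_eq.
  by rewrite /GRing.scale/= mulrCA mulVf ?mulr1.
have dC (t : R) : is_derive t 1 (fun x => - a^-1 * cos (a * x)) (sin (a * t)).
  have ? := dL t; apply: is_derive_eq.
  by rewrite /GRing.scale/=; field.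
have cC := @continuous_scale a _ (@continuous_cos R).
have cS := @continuous_scale a _ (@continuous_sin R).
split.
- rewrite (integral_period_FTC cC (fun t => cos_max (a * t)) dS).
  by rewrite mulr0 sin0 (sincos_int_period n).1 mulr0 subr0.
- rewrite (integral_period_FTC cS (fun t => sin_max (a * t)) dC).
  by rewrite mulr0 cos0 (sincos_int_period n).2 subrr.
Qed.

End characters.

(** * Fourier coefficients on the period *)

Section hardy_on_period.
Variable R : realType.
Local Notation leb := (@completed_lebesgue_measure R).
Local Notation lebT := (caratheodory_type (wlength (@idfun R))^*%mu).
Local Notation period := (@period R : set lebT).
Local Notation sqint := (sqint leb period).
Local Notation ip := (ip leb period).
Local Notation nrm2 := (nrm2 leb).
Let mP : measurable (period : set lebT) := @measurable_period R.
Implicit Types (u v w g k : lebT -> R[i]) (n m : int) (c : R[i]) (A B : set lebT).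

Lemma completed_aeS (P Q : lebT -> Prop) : (forall t, P t -> Q t) ->
  {ae leb, forall t, P t} -> {ae leb, forall t, Q t}.
Proof. exact: (@filterS _ _ (ae_filter_ringOfSetsType leb)). Qed.

Lemma completed_aeS2 (P Q S : lebT -> Prop) : (forall t, P t -> Q t -> S t) ->
  {ae leb, forall t, P t} -> {ae leb, forall t, Q t} -> {ae leb, forall t, S t}.
Proof. exact: (@filterS2 _ _ (ae_filter_ringOfSetsType leb)). Qed.

Lemma expiD (a b : R) : expi (a + b) = expi a * expi b.
Proof. by rewrite /expi cosD sinD; congr Complex; rewrite addrC. Qed.

Lemma conjc_expi (a : R) : conjc (expi a) = expi (- a).
Proof. by rewrite /expi/= cosN sinN. Qed.

Lemma nsq_expi (a : R) : nsq (expi a) = 1.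
Proof. by rewrite /nsq /dotc/= -!expr2 cos2Dsin2. Qed.

Lemma expi0 : expi 0 = 1 :> R[i].
Proof. by rewrite /expi cos0 sin0. Qed.

Definition chi n (t : R) : R[i] := expi (n%:~R * t).

Lemma chiD n m t : chi (n + m) t = chi n t * chi m t.
Proof. by rewrite /chi -expiD intrD mulrDl. Qed.

Lemma chi0 t : chi 0 t = 1.
Proof. by rewrite /chi mul0r expi0. Qed.

Lemma conjc_chi n t : conjc (chi n t) = chi (- n) t.
Proof. by rewrite /chi conjc_expi intrN mulNr. Qed.

Lemma continuous_chi n : continuous (fun t : R => cos (n%:~R * t)) /\
  continuous (fun t : R => sin (n%:~R * t)).
Proof.
by split; apply: continuous_scale; [exact: continuous_cos|exact: continuous_sin].
Qed.

Lemma cmeas_chi n : cmeas period (chi n : lebT -> R[i]).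
Proof.
have [cC cS] := continuous_chi n.
by split; [exact: (continuous_completed_measurable mP cC)
          |exact: (continuous_completed_measurable mP cS)].
Qed.

Lemma sqint_chiM n u : sqint u -> sqint (fun t => chi n t * u t).
Proof.
move=> su; apply: (@sqintM _ _ _ leb period mP (chi n) u 1 (cmeas_chi n) _ su).
by move=> t _; rewrite nsq_expi.
Qed.

Lemma sqint_chi c n : sqint (fun t => c * chi n t).
Proof.
apply: (sqintZ mP); split; first exact: cmeas_chi.
rewrite (_ : (fun t => _) = EFin \o (fun=> 1)); first exact: integrable_cst_period.
by apply/funext => t /=; rewrite nsq_expi.
Qed.

Lemma dotc_chi u n c t : dotc (u t) (c * chi n t) =
  complex.Re (conjc c * u t) * cos (n%:~R * t) +
  complex.Im (conjc c * u t) * sin (n%:~R * t).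
Proof. by rewrite /chi /dotc !ReIm/=; ring. Qed.

Lemma ip_chi_eq0 n m c c' : n != m ->
  ip (fun t => c' * chi n t) (fun t => c * chi m t) = 0.
Proof.
move=> nm; have k0 : m - n != 0 by rewrite subr_eq0 eq_sym.
have [I1 I2] := integral_char R k0.
have [cC cS] := continuous_chi (m - n).
have iC := bounded_integrable_period cC (fun t => cos_max _).
have iS := bounded_integrable_period cS (fun t => sin_max _).
set a := complex.Re (conjc c * c'); set b := complex.Im (conjc c * c').
rewrite /ip (@eq_Rintegral _ _ _ leb period (fun t => a * cos ((m - n)%:~R * t)
    + b * sin ((m - n)%:~R * t))).
  rewrite RintegralD//; [|exact: integrableZR|exact: integrableZR].
  by rewrite !RintegralZl// I1 I2 !mulr0 addr0.
move=> t _; rewrite -[c' * chi n t]mulrC dotcMl conjc_chi mulrCA -chiD addrC.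
exact: (@dotc_chi (fun=> c')).
Qed.

Lemma ip_chiM u n m c : ip (fun t => chi m t * u t) (fun t => c * chi n t) =
  ip u (fun t => c * chi (n - m) t).
Proof.
apply: eq_Rintegral => t _.
by rewrite dotcMl conjc_chi mulrCA -chiD addrC.
Qed.

Lemma ip_mull a u v : ip (fun t => a * u t) v = ip u (fun t => conjc a * v t).
Proof. by apply: eq_Rintegral => t _; rewrite dotcMl. Qed.

(** The frequencies [n] and [- n] with suitable [c] isolate the real trigonometric
   coefficients of the real and imaginary parts. *)
Lemma fourier_ae0 u : sqint u -> (forall n c, ip u (fun t => c * chi n t) = 0) ->
  {ae leb, forall t, period t -> u t = 0}.
Proof.
move=> su u0.
have null (phi p : R -> R) n c c' :
    (forall t, phi t * p t =
       2^-1 * (dotc (u t) (c * chi n t) + dotc (u t) (c' * chi (- n) t))) ->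
    null_against phi p.
  move=> e; have i1 := dot_integrable mP su (sqint_chi c n).
  have i2 := dot_integrable mP su (sqint_chi c' (- n)).
  have E : (fun t => phi t * p t) = fun t =>
       2^-1 * (dotc (u t) (c * chi n t) + dotc (u t) (c' * chi (- n) t)).
    exact/funext.
  rewrite /null_against E; split.
    by apply: integrableZR => //; exact: integrableDR.
  rewrite RintegralZl//; last exact: integrableDR.
  by rewrite RintegralD// -!/(ip _ _) !u0 addr0 mulr0.
have iP : trig_null (fun t => complex.Re (u t)).
  move=> n; split.
  - apply: (null _ _ n 1 1) => t; rewrite !dotc_chi !ReIm/=.
    by rewrite intrN (mulNr n%:~R) cosN sinN; field.
  - apply: (null _ _ n (Complex 0 (-1)) (Complex 0 1)) => t.
    by rewrite !dotc_chi !ReIm/= intrN (mulNr n%:~R) cosN sinN; field.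
have iQ : trig_null (fun t => complex.Im (u t)).
  move=> n; split.
  - apply: (null _ _ n (Complex 0 1) (Complex 0 1)) => t.
    by rewrite !dotc_chi !ReIm/= intrN (mulNr n%:~R) cosN sinN; field.
  - apply: (null _ _ n 1 (-1)) => t; rewrite !dotc_chi !ReIm/=.
    by rewrite intrN (mulNr n%:~R) cosN sinN; field.
apply: completed_aeS2 (trig_null_ae0 iP) (trig_null_ae0 iQ) => t h1 h2 Pt.
by move: (h1 Pt) (h2 Pt); case: (u t) => x y /= -> ->.
Qed.

Lemma nrm2_eq0 A u : measurable A -> A `<=` period -> sqint u ->
  nrm2 A u = 0 -> {ae leb, forall t, A t -> u t = 0}.
Proof.
move=> mA AP su u0; have iu := nsq_integrable mP mA AP su.
have mu_ : measurable_fun A (fun t => (nsq (u t))%:E) by case/integrableP: iu.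
have : (\int[leb]_(t in A) `|(nsq (u t))%:E| = 0)%E.
  under eq_integral do rewrite gee0_abs ?lee_fin ?nsq_ge0//.
  by rewrite -[LHS]fineK ?integrable_fin_num//; congr EFin.
move=> /(ae_eq_integral_abs leb mA mu_); apply: completed_aeS => t h At.
by have /= [] := h At; exact: nsq_eq0.
Qed.

Lemma ae0_nrm2 A u : measurable A -> A `<=` period -> sqint u ->
  {ae leb, forall t, A t -> u t = 0} -> nrm2 A u = 0.
Proof.
move=> mA AP su u0; have iu := nsq_integrable mP mA AP su.
have mu_ : measurable_fun A (fun t => (nsq (u t))%:E) by case/integrableP: iu.
rewrite /nrm2 /Rintegral.
rewrite (@ae_eq_integral _ _ _ leb A (cst 0%E) _ mA mu_ (measurable_cst _)).
- by rewrite (integral_cst _ mA) mul0e.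
- by move: u0; apply: completed_aeS => t h At; rewrite (h At) nsq0.
Qed.

End hardy_on_period.

#[local] Opaque ip nrm2.

(** * Functions of H2 vanishing on a set of positive measure *)

Section riesz.
Variable R : realType.
Local Notation leb := (@completed_lebesgue_measure R).
Local Notation lebT := (caratheodory_type (wlength (@idfun R))^*%mu).
Local Notation period := (@period R : set lebT).
Local Notation sqint := (sqint leb period).
Local Notation ip := (ip leb period).
Local Notation nrm2 := (nrm2 leb).
Let mP : measurable (period : set lebT) := @measurable_period R.
Implicit Types (u v w g k : lebT -> R[i]) (n m : int) (c : R[i]) (A B : set lebT).

(** H2 on the period.  The real inner product against all complex multiples of a
   character carries the complex Fourier coefficient, and turns membership into
   a family of closed real-linear conditions. *)
Definition hardy u := sqint u /\
  forall n, n < 0 -> forall c, ip u (fun t => c * chi n t) = 0.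

Lemma hardyD u v : hardy u -> hardy v -> hardy (fun t => u t + v t).
Proof.
move=> [su hu] [sv hv]; split; first exact: sqintD.
by move=> n n0 c; rewrite (ipD mP su sv (sqint_chi c n)) (hu n n0 c) (hv n n0 c) addr0.
Qed.

Lemma hardyZ c u : hardy u -> hardy (fun t => c * u t).
Proof.
move=> [su hu]; split; first exact: sqintZ.
move=> n n0 c'; rewrite ip_mull -(hu n n0 (conjc c * c')).
by apply: eq_ip => t; rewrite mulrA.
Qed.

Lemma hardyB u v : hardy u -> hardy v -> hardy (fun t => u t - v t).
Proof.
move=> hu hv; have := hardyD hu (hardyZ (-1) hv).
by congr hardy; apply/funext => t; rewrite mulN1r.
Qed.

Lemma hardy_midpoint u v : hardy u -> hardy v -> hardy (midpoint u v).
Proof. by move=> hu hv; apply: hardyZ; exact: hardyD. Qed.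

Lemma hardy_chi c n : 0 <= n -> hardy (fun t => c * chi n t).
Proof.
move=> n0; split; first exact: sqint_chi.
by move=> m m0 c'; apply: ip_chi_eq0; rewrite gt_eqF// (lt_le_trans m0).
Qed.

Lemma hardy_chiM n u : 0 <= n -> hardy u -> hardy (fun t => chi n t * u t).
Proof.
move=> n0 [su hu]; split; first exact: sqint_chiM.
move=> m m0 c; rewrite ip_chiM; apply: hu.
by rewrite subr_lt0 (lt_le_trans m0).
Qed.

Lemma hardy_closed u : sqint u -> (forall e, 0 < e ->
  exists2 v, hardy v & nrm2 period (fun t => u t - v t) <= e) -> hardy u.
Proof.
move=> su cu; split=> // n n0 c; apply: (ip_closed mP su (sqint_chi c n)).
move=> e e0; have [v [sv hv] uv] := cu e e0.
by exists v; split=> //; exact: hv.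
Qed.

Lemma nrm2_eq0_closed A u : measurable A -> A `<=` period -> sqint u ->
  (forall e, 0 < e -> exists v, [/\ sqint v, nrm2 A v = 0 &
     nrm2 period (fun t => u t - v t) <= e]) -> nrm2 A u = 0.
Proof.
move=> mA AP su cu; apply/eqP; rewrite eq_le nrm2_ge0 andbT.
have E w : nrm2 A (fun t => w t - 0) = nrm2 A w.
  by apply: eq_nrm2 => t; rewrite subr0.
apply/ler_addgt0Pr => e e0.
have [dl dl0 H] := nrm2_lsc mP mA AP su (sqint0 leb period) e0.
have [v [sv v0 uv]] := cu _ dl0.
by have := H _ sv uv; rewrite !E v0.
Qed.

Lemma nrm2M_eq0 A u w : measurable A -> A `<=` period -> sqint u ->
  sqint (fun t => w t * u t) -> nrm2 A u = 0 -> nrm2 A (fun t => w t * u t) = 0.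
Proof.
move=> mA AP su swu /(nrm2_eq0 mA AP su) H; apply: ae0_nrm2 => //.
by move: H; apply: completed_aeS => t h At; rewrite (h At) mulr0.
Qed.

Lemma nrm2Z_eq0 A u c : measurable A -> A `<=` period -> sqint u ->
  nrm2 A u = 0 -> nrm2 A (fun t => c * u t) = 0.
Proof.
move=> mA AP su.
exact: (@nrm2M_eq0 A u (fun=> c) mA AP su (sqintZ mP c su)).
Qed.

Lemma nrm2_chiM_eq0 A u n : measurable A -> A `<=` period -> sqint u ->
  nrm2 A u = 0 -> nrm2 A (fun t => chi n t * u t) = 0.
Proof.
move=> mA AP su.
exact: (@nrm2M_eq0 A u (chi n) mA AP su (sqint_chiM n su)).
Qed.

Lemma nrm2D_eq0 A u v : measurable A -> A `<=` period -> sqint u -> sqint v ->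
  nrm2 A u = 0 -> nrm2 A v = 0 -> nrm2 A (fun t => u t + v t) = 0.
Proof.
move=> mA AP su sv u0 v0; apply/eqP; rewrite eq_le nrm2_ge0 andbT.
apply: (le_trans (@nrm2_le _ _ _ leb period mP A _ u v 2 2 mA AP
  (sqintD mP su sv) su sv _)).
  by move=> t _; rewrite -mulrDr; exact: nsqD_le.
by rewrite u0 v0 mulr0 addr0.
Qed.

(** A function orthogonal to all its rotations [chi n * g] has a modulus whose
   Fourier coefficients vanish, except for the mean. *)
Lemma modulus_constant g : sqint g ->
  (forall n c, 0 < n -> ip g (fun t => c * (chi n t * g t)) = 0) ->
  exists r : R, {ae leb, forall t, period t -> nsq (g t) = r}.
Proof.
move=> sg orth.
pose r := (2 * pi)^-1 * nrm2 period g; exists r.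
suff : trig_null (fun t => nsq (g t) - r).
  move=> /trig_null_ae0; apply: completed_aeS => t h Pt.
  by apply/eqP; rewrite -subr_eq0; apply/eqP/h.
have ig : leb.-integrable period (EFin \o (fun t => nsq (g t))) by case: sg.
have orth' n c : n != 0 -> ip g (fun t => c * (chi n t * g t)) = 0.
  rewrite neq_lt => /orP[n0|]; last exact: orth.
  rewrite -(orth (- n) (conjc c)) ?oppr_gt0//.
  apply: eq_ip => t.
  by rewrite -conjc_chi /dotc !ReIm; ring.
have pc n : continuous (fun t : R => cos (n%:~R * t)) by have [] := continuous_chi R n.
have ps n : continuous (fun t : R => sin (n%:~R * t)) by have [] := continuous_chi R n.
have intM (p : R -> R) : continuous p -> (forall t, `|p t| <= 1) ->
    leb.-integrable period (EFin \o (fun t => nsq (g t) * p t)).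
  move=> cp p1.
  apply: (@le_integrableR _ _ _ leb period mP _ (fun t => nsq (g t)) _ _ ig).
    apply: measurable_funM; last exact: (continuous_completed_measurable mP cp).
    by case/integrableP: ig => /measurable_EFinP.
  move=> t _; rewrite normrM (ger0_norm (nsq_ge0 _)).
  by rewrite ler_piMr// nsq_ge0.
have key (p : R -> R) : continuous p -> (forall t, `|p t| <= 1) ->
    \int[leb]_(t in period) (nsq (g t) * p t) =
      r * \int[leb]_(t in period) p t ->
    null_against (fun t => nsq (g t) - r) p.
  move=> cp p1 e.
  have ip1 := bounded_integrable_period cp p1.
  have irp : leb.-integrable period (EFin \o (fun t => r * p t)).
    exact: integrableZR.
  rewrite /null_against (_ : (fun t => (nsq (g t) - r) * p t) =
    (fun t => nsq (g t) * p t - r * p t)); last by apply/funext => t; ring.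
  split; last by rewrite RintegralB ?intM// RintegralZl// e subrr.
  by apply: (integrableB mP (intM _ cp p1) irp).
have cosE n t : dotc (g t) (1 * (chi n t * g t)) = nsq (g t) * cos (n%:~R * t).
  by rewrite /chi /nsq /dotc !ReIm/=; ring.
have sinE n t : dotc (g t) (Complex 0 (-1) * (chi n t * g t)) =
    nsq (g t) * sin (n%:~R * t).
  by rewrite /chi /nsq /dotc !ReIm/=; ring.
move=> n; split; apply: key => //.
- by move=> t; exact: cos_max.
- have [->|n0] := eqVneq n 0.
    under eq_Rintegral do rewrite mul0r cos0 mulr1.
    under [in RHS]eq_Rintegral do rewrite mul0r cos0.
    rewrite (Rintegral_cst _ mP) [X in fine X]completed_measure_period mul1r.
    rewrite mulrC /r nrm2E.
    by rewrite mulVKf// gt_eqF// mulr_gt0// pi_gt0.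
  rewrite (integral_char R n0).1 mulr0 -(orth' n 1 n0) ipE.
  by apply: eq_Rintegral => t _; rewrite cosE.
- by move=> t; exact: sin_max.
- have [->|n0] := eqVneq n 0.
    under eq_Rintegral do rewrite mul0r sin0 mulr0.
    under [in RHS]eq_Rintegral do rewrite mul0r sin0.
    by rewrite !(Rintegral_cst _ mP) !mul0r mulr0.
  rewrite (integral_char R n0).2 mulr0 -(orth' n (Complex 0 (-1)) n0) ipE.
  by apply: eq_Rintegral => t _; rewrite sinE.
Qed.

Section vanishing.
Variable A : set lebT.
Hypotheses (mA : measurable A) (AP : A `<=` period) (A0 : (0 < leb A)%E).

Lemma ae_constant_vanishing g (r : R) : sqint g ->
  {ae leb, forall t, period t -> nsq (g t) = r} -> nrm2 A g = 0 ->
  {ae leb, forall t, period t -> g t = 0}.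
Proof.
move=> sg gr /(nrm2_eq0 mA AP sg) g0.
suff r0 : r = 0.
  by move: gr; apply: completed_aeS => t h Pt; apply: nsq_eq0; rewrite h.
apply: contrapT => r0.
have : {ae leb, forall t, ~ A t}.
  apply: completed_aeS2 gr g0 => t h1 h2 At; apply: r0.
  by rewrite -(h1 (AP At)) (h2 At) nsq0.
move=> [N [mN N0 sN]]; move: A0; rewrite lt0e => /andP[/eqP + _]; apply.
apply: (subset_measure0 mA mN) => // t At; apply: sN => /= nA; exact: nA.
Qed.

(** The element of least norm among those with the same mean and the same
   vanishing set is orthogonal to its rotations, hence of constant modulus,
   hence zero. *)
Lemma vanishing_mean u c : hardy u -> nrm2 A u = 0 ->
  ip u (fun t => c * chi 0 t) = 0.
Proof.
move=> hu u0; have [su _] := hu.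
pose C : set (lebT -> R[i]) := [set g | [/\ hardy g, nrm2 A g = 0 &
  forall c, ip g (fun t => c * chi 0 t) = ip u (fun t => c * chi 0 t)]].
have cC : convex_closed leb period C.
  split.
  - by move=> g [[]].
  - move=> g g' [hg g0 gu] [hg' g'0 g'u].
    have [sg _] := hg; have [sg' _] := hg'.
    have sD := sqintD mP sg sg'.
    split; first exact: hardy_midpoint.
      exact: (nrm2Z_eq0 _ mA AP sD (nrm2D_eq0 mA AP sg sg' g0 g'0)).
    move=> c'; rewrite /midpoint half_complex (ipZ mP _ sD (sqint_chi c' 0)).
    by rewrite (ipD mP sg sg' (sqint_chi c' 0)) gu g'u; field.
  - move=> g sg cg; split.
    + apply: (hardy_closed sg) => e e0; have [v [hv _ _] gv] := cg e e0.
      by exists v.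
    + apply: (nrm2_eq0_closed mA AP sg) => e e0; have [v [[sv _] v0 _] gv] := cg e e0.
      by exists v.
    + move=> c'; apply: (ip_closed mP sg (sqint_chi c' 0)) => e e0.
      by have [v [[sv _] _ vu] gv] := cg e e0; exists v.
have Cu : C u by split.
have [g [hg g0 gu] gmin] := nearest_point mP (sqint0 leb period) cC (ex_intro _ u Cu).
have [sg hg'] := hg.
have E w : nrm2 period (fun t => w t - 0) = nrm2 period w.
  by apply: eq_nrm2 => t; rewrite subr0.
have orth n c' : 0 < n -> ip g (fun t => c' * (chi n t * g t)) = 0.
  move=> n0; have hv : hardy (fun t => c' * (chi n t * g t)).
    exact: (hardyZ _ (hardy_chiM (ltW n0) hg)).
  have [sv _] := hv; have sng := sqint_chiM n sg.
  apply: (min_orthogonal mP sg sv) => s.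
  rewrite -[leLHS]E -[leRHS]E; apply: (gmin (fun t => g t + _)); split.
  - exact: (hardyD hg (hardyZ _ hv)).
  - apply: (nrm2D_eq0 mA AP sg (sqintZ mP _ sv) g0).
    apply: (nrm2Z_eq0 _ mA AP sv); apply: (nrm2Z_eq0 _ mA AP sng).
    exact: (nrm2_chiM_eq0 n mA AP sg g0).
  - move=> d; rewrite (ipD mP sg (sqintZ mP _ sv) (sqint_chi d 0)).
    rewrite (ipZ mP _ sv (sqint_chi d 0)).
    rewrite ip_mull (_ : ip (fun t => chi n t * g t)
      (fun t => conjc c' * (d * chi 0 t)) = 0).
      by rewrite mulr0 addr0.
    have -> : ip (fun t => chi n t * g t) (fun t => conjc c' * (d * chi 0 t)) =
        ip (fun t => chi n t * g t) (fun t => (conjc c' * d) * chi 0 t).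
      by apply: eq_ip => t; rewrite mulrA.
    by rewrite ip_chiM hg' ?sub0r ?oppr_lt0.
have [r gr] := modulus_constant sg orth.
have g_ae := ae_constant_vanishing sg gr g0.
rewrite -gu; have n0 : nrm2 period g = 0.
  exact: (ae0_nrm2 mP (@subset_refl _ _) sg g_ae).
apply: (ip_closed mP sg (sqint_chi c 0)) => e e0.
exists (fun=> 0); split; first exact: sqint0.
  by rewrite E n0 ltW.
exact: ip0l.
Qed.

(** As the mean of [u] vanishes, dividing [u] by [chi 1] stays in H2 and keeps the
   vanishing on [A]; iterating, every coefficient of [u] is the mean of such a
   quotient. *)
Theorem hardy_unique u : hardy u -> nrm2 A u = 0 ->
  {ae leb, forall t, period t -> u t = 0}.
Proof.
move=> hu u0; have [su hu'] := hu.
have shift (n : nat) : hardy (fun t => chi (- n%:Z) t * u t) /\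
    nrm2 A (fun t => chi (- n%:Z) t * u t) = 0.
  have s (j : int) : sqint (fun t => chi j t * u t) by exact: sqint_chiM.
  split; last exact: (nrm2_chiM_eq0 _ mA AP su u0).
  elim: n => [|n [_ IH]]; first by
    rewrite (_ : (fun t => _) = u)//; apply/funext => t; rewrite oppr0 chi0 mul1r.
  split; first exact: s.
  move=> m m0 c; rewrite ip_chiM opprK -[n.+1]addn1 PoszD.
  have [m1|m1] : m = - 1 \/ m + 1 < 0 by lia.
    have -> : m + (n%:Z + 1) = 0 - - n%:Z by lia.
    rewrite -ip_chiM; apply: vanishing_mean; first by split; [exact: s|].
    exact: (nrm2_chiM_eq0 _ mA AP su u0).
  have -> : m + (n%:Z + 1) = (m + 1) - - n%:Z by lia.
  by rewrite -ip_chiM IH.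
apply: (fourier_ae0 su) => n c; have [n0|n0] := ltP n 0; first exact: (hu' n n0 c).
have [h v] := shift (absz n).
have -> : n = 0 - - (absz n)%:Z by lia.
by rewrite -ip_chiM; exact: (vanishing_mean c h v).
Qed.

End vanishing.
End riesz.

(** * Density and the extremal problem on the period *)

Section extremal_problem.
Variable R : realType.
Local Notation leb := (@completed_lebesgue_measure R).
Local Notation lebT := (caratheodory_type (wlength (@idfun R))^*%mu).
Local Notation period := (@period R : set lebT).
Local Notation sqint := (sqint leb period).
Local Notation ip := (ip leb period).
Local Notation nrm2 := (nrm2 leb).
Let mP : measurable (period : set lebT) := @measurable_period R.
Implicit Types (u v w g k : lebT -> R[i]) (c : R[i]).
Variables A B : set lebT.
Hypotheses (mA : measurable A) (mB : measurable B) (AB : A `|` B = period).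
Hypotheses (disjAB : A `&` B = set0) (A0 : (0 < leb A)%E).

Let AP : A `<=` period. Proof. by rewrite -AB => t; left. Qed.
Let BP : B `<=` period. Proof. by rewrite -AB => t; right. Qed.

Definition restr u : lebT -> R[i] := fun t => (\1_B t)%:C%C * u t.

Lemma sqint_restr u : sqint u -> sqint (restr u).
Proof.
move=> su.
apply: (@sqintM _ _ _ leb period mP (fun t => (\1_B t)%:C%C) u 1 _ _ su).
  split; last exact: measurable_cst.
  by apply: measurable_funTS; exact: measurable_indic.
move=> t _; rewrite /nsq /dotc/= mulr0 addr0 indicE.
by case: (_ \in _); rewrite ?mulr1// mulr0.
Qed.

Lemma restrE u t : B t -> restr u t = u t.
Proof. by move=> Bt; rewrite /restr indicE mem_set// mul1r. Qed.

Lemma restr_out u t : A t -> restr u t = 0.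
Proof.
move=> At; rewrite /restr indicE memNset ?mul0r// => Bt.
by have : (A `&` B) t by []; rewrite disjAB.
Qed.

Lemma ip_restr u v : ip (restr u) v = ip u (restr v).
Proof. by apply: eq_ip => t; rewrite /restr /dotc !ReIm/=; ring. Qed.

Lemma ip_conj u v : ip (fun t => conjc (u t)) v = ip u (fun t => conjc (v t)).
Proof. by apply: eq_ip => t; rewrite /dotc !ReIm; ring. Qed.

(** The residual of the projection onto the closure of the restrictions is
   orthogonal to all of H2; its conjugate is then itself in H2, and vanishes
   on [A]. *)
Lemma hardy_dense k (e : R) : sqint k -> 0 < e ->
  exists2 g, hardy g & nrm2 B (fun t => g t - k t) <= e.
Proof.
move=> sk e0; have srk := sqint_restr sk.
pose C : set (lebT -> R[i]) := [set u | exists2 g, hardy g & u = restr g].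
have sC u : C u -> sqint u by move=> [g [sg _] ->]; exact: sqint_restr.
have midC u v : C u -> C v -> C (midpoint u v).
  move=> [g hg ->] [h hh ->]; exists (midpoint g h); first exact: hardy_midpoint.
  by apply/funext => t; rewrite /midpoint /restr; ring.
have C0 : exists u, L2closure leb period C u.
  exists (restr (fun t => 0 * chi 0 t)); apply: (sub_L2closure mP sC).
  by exists (fun t => 0 * chi 0 t); first exact: hardy_chi.
have [w [sw cw] wmin] :=
  nearest_point mP srk (convex_closed_closure mP sC midC) C0.
pose v t := w t - restr k t.
have sv : sqint v := sqintB mP sw srk.
have orth g : hardy g -> ip (restr v) g = 0.
  move=> hg; have [sg _] := hg; have srg := sqint_restr sg.
  rewrite ip_restr; apply: (min_orthogonal mP sv srg) => s.
  have sws := sqintD mP sw (sqintZ mP s%:C%C srg).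
  apply: (le_trans (wmin (fun t => w t + s%:C%C * restr g t) _)).
    split; first exact: sws.
    move=> d d0; have [_ [h hh ->] wh] := cw d d0.
    exists (restr (fun t => h t + s%:C%C * g t)).
      by exists (fun t => h t + s%:C%C * g t); first exact: (hardyD hh (hardyZ _ hg)).
    apply: le_trans wh; rewrite le_eqVlt; apply/orP; left; apply/eqP.
    by apply: eq_nrm2 => t; congr nsq; rewrite /restr; ring.
  rewrite le_eqVlt; apply/orP; left; apply/eqP.
  by apply: eq_nrm2 => t; congr nsq; rewrite /v; ring.
pose u' t := conjc (restr v t).
have srv := sqint_restr sv; have su' := sqintJ mP srv.
have hu' : hardy u'.
  split; first exact: su'.
  move=> n n0 c; rewrite ip_conj.
  have -> : ip (restr v) (fun t => conjc (c * chi n t)) =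
      ip (restr v) (fun t => conjc c * chi (- n) t).
    by apply: eq_ip => t; rewrite conjcM conjc_chi.
  by apply: orth; apply: hardy_chi; rewrite oppr_ge0 ltW.
have u'A : nrm2 A u' = 0.
  apply: (ae0_nrm2 mA AP su'); apply: aeW => t At.
  by rewrite /u' restr_out// conjc0.
have v0 : nrm2 B v = 0.
  apply: (ae0_nrm2 mB BP sv).
  apply: completed_aeS (hardy_unique mA AP A0 hu' u'A) => t h Bt.
  have := h (BP Bt); rewrite /u' restrE// => /eqP.
  by rewrite conjc_eq0 => /eqP.
have [_ [g hg ->] wg] := cw (e / 2) (divr_gt0 e0 (ltr0Sn _ 1)).
have [sg _] := hg; have srg := sqint_restr sg.
have swg := sqintB mP sw srg.
exists g; first exact: hg.
apply: (@le_trans _ _ (2 * nrm2 B v + 2 * nrm2 B (fun t => w t - restr g t))).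
  apply: (@nrm2_le _ _ _ leb period mP B _ v _ 2 2 mB BP (sqintB mP sg sk) sv swg).
  move=> t Bt; rewrite -mulrDr.
  have -> : g t - k t = v t - (w t - restr g t) by rewrite /v !restrE//; ring.
  exact: nsqB_le.
have wgB := le_trans (nrm2_subset mP mB BP swg) wg.
rewrite v0 mulr0 add0r (le_trans (ler_wpM2l (ler0n R 2) wgB))//.
by rewrite mulrCA mulfV ?mulr1// pnatr_eq0.
Qed.

Lemma parallelogram_min (m x y e : R) : 4 * m + e = 2 * (x + y) -> x <= y ->
  y <= m -> 0 <= e -> e = 0.
Proof. by move=> ? ? ? ?; apply/eqP; rewrite eq_le; apply/andP; split; lra. Qed.

Lemma nrm2_split u : sqint u -> nrm2 period u = nrm2 A u + nrm2 B u.
Proof.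
move=> su; rewrite !nrm2E -AB Rintegral_setU//.
- by rewrite AB; case: su.
- by apply/disj_set2P; rewrite disjAB.
Qed.

Lemma feasible_convex_closed k (M2 : R) : sqint k ->
  convex_closed leb period
    [set g | hardy g /\ nrm2 B (fun t => g t - k t) <= M2].
Proof.
move=> sk; split.
- by move=> g [[]].
- move=> g h [hg gM] [hh hM]; split; first exact: hardy_midpoint.
  by have [sg _] := hg; have [sh _] := hh; exact: (nrm2_midpoint_le mP mB BP).
- move=> g sg cg; split.
    apply: (hardy_closed sg) => e e0; have [h [hh _] gh] := cg e e0.
    by exists h.
  apply/ler_addgt0Pr => e e0.
  have [dl dl0 H] := nrm2_lsc mP mB BP sg sk e0.
  have [h [[sh _] hM] gh] := cg dl dl0.
  by apply: (le_trans (H _ sh gh)); rewrite lerD2r.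
Qed.

(** A minimizing sequence is bounded on [A] by minimality and on [B] by the
   constraint, hence on the whole circle; two minimizers agree on [A] by strict
   convexity of the norm, and then everywhere. *)
Theorem hardy_extremal k (M2 : R) : sqint k ->
  (exists2 g, hardy g & nrm2 B (fun t => g t - k t) <= M2) ->
  exists g0, [/\ hardy g0, nrm2 B (fun t => g0 t - k t) <= M2,
    forall g, hardy g -> nrm2 B (fun t => g t - k t) <= M2 ->
      nrm2 A (fun t => g0 t - k t) <= nrm2 A (fun t => g t - k t) &
    forall g, hardy g -> nrm2 B (fun t => g t - k t) <= M2 ->
      nrm2 A (fun t => g t - k t) <= nrm2 A (fun t => g0 t - k t) ->
      {ae leb, forall t, period t -> g t = g0 t}].
Proof.
move=> sk [g1 hg1 g1M].
pose F : set (lebT -> R[i]) :=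
  [set g | hardy g /\ nrm2 B (fun t => g t - k t) <= M2].
pose p g := nrm2 A (fun t => g t - k t).
pose m := inf (p @` F).
have lbF : has_lbound (p @` F) by exists 0 => _ [g _ <-]; exact: nrm2_ge0.
have infF : has_inf (p @` F) by split=> //; exists (p g1), g1.
have cF := feasible_convex_closed M2 sk.
have sF g : F g -> sqint g by move=> [[]].
have [|g0 [[hg0 g0M] g0min _]] :=
  @L2_lexicographic_min _ _ _ leb period mP F A k (m + 1 + M2) mA AP sk cF.
  move=> e e0; have d0 : 0 < Num.min e 1 by rewrite lt_min e0 ltr01.
  have [_ [g Fg <-] gm] := inf_adherent d0 infF.
  have [hg gM] := Fg.
  exists g; split=> // [h Fh|].
    apply: (le_trans (ltW gm)); rewrite lerD// ?ge_min ?lexx//.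
    by apply: ge_inf => //; exists h.
  rewrite (nrm2_split (sqintB mP (sF _ Fg) sk)) lerD//.
  by apply: (le_trans (ltW gm)); rewrite lerD2l ge_min lexx orbT.
exists g0; split=> // [g hg gM|g hg gM gmin]; first by apply: g0min; split.
have [sg _] := hg; have [sg0 _] := hg0.
have hd := hardyB hg hg0; have [sd _] := hd.
suff d0 : nrm2 A (fun t => g t - g0 t) = 0.
  apply: completed_aeS (hardy_unique mA AP A0 hd d0) => t h Pt.
  by apply/eqP; rewrite -subr_eq0; apply/eqP/h.
have [_ midF _] := cF.
apply: (parallelogram_min (parallelogram mP mA AP sg sg0 sk) gmin).
  exact: (g0min _ (midF g g0 (conj hg gM) (conj hg0 g0M))).
exact: nrm2_ge0.
Qed.

End extremal_problem.

(** * From the circle to the period *)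

#[local] Transparent ip nrm2.

Section square_integrable_gluing.
Context d (T : measurableType d) (R : realType).
Variable mu : {measure set T -> \bar R}.
Implicit Types (u v : T -> R[i]) (A B D : set T).

Lemma eq_cmeas D u v : {in D, u =1 v} -> cmeas D u -> cmeas D v.
Proof.
move=> uv [u1 u2]; split; [move: u1|move: u2];
  by apply: eq_measurable_fun => t Dt; rewrite uv.
Qed.

Lemma eq_sqint D u v : measurable D -> {in D, u =1 v} ->
  sqint mu D u -> sqint mu D v.
Proof.
move=> mD uv [mu_ iu]; split; first exact: eq_cmeas uv mu_.
by apply: (eq_integrable mD _ _ _ iu) => t Dt; rewrite uv.
Qed.

Lemma sqint_setU A B u : measurable A -> measurable B -> A `&` B = set0 ->
  sqint mu A u -> sqint mu B u -> sqint mu (A `|` B) u.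
Proof.
move=> mA mB AB [[uA vA] /integrableP[iA fA]] [[uB vB] /integrableP[iB fB]].
split; first by split; apply/measurable_funU.
apply/integrableP; split; first exact/measurable_funU.
rewrite ge0_integral_setU//.
- by rewrite lte_add_pinfty.
- by apply/measurable_funU => //; split; exact: measurableT_comp.
- by apply/disj_set2P.
Qed.

Lemma measurable_invr D (f : T -> R) : measurable D -> measurable_fun D f ->
  (forall t, D t -> 0 <= f t) -> measurable_fun D (fun t => (f t)^-1).
Proof.
move=> mD mf f0; have := measurableT_comp (@measurable_powR R (-1)) mf.
apply: eq_measurable_fun => t; rewrite inE => Dt /=.
by rewrite powR_inv1// f0.
Qed.

Lemma cmeasV D u : measurable D -> cmeas D u -> cmeas D (fun t => (u t)^-1).
Proof.
move=> mD mu_; have [u1 u2] := mu_.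
have mi : measurable_fun D (fun t => (nsq (u t))^-1).
  apply: measurable_invr => //; first exact: measurable_dotc.
  by move=> t _; exact: nsq_ge0.
have ReV a : complex.Re a^-1 = complex.Re a * (nsq a)^-1.
  by case: a => x y; rewrite /nsq /dotc/= -!expr2.
have ImV a : complex.Im a^-1 = - complex.Im a * (nsq a)^-1.
  by case: a => x y; rewrite /nsq /dotc/= -!expr2 mulNr.
split.
- by under eq_fun do rewrite ReV; exact: measurable_funM.
- under eq_fun do rewrite ImV; apply: measurable_funM => //.
  exact: measurableT_comp.
Qed.

Lemma cmeas_prod D (I : Type) (s : seq I) (u : I -> T -> R[i]) :
  (forall i, cmeas D (u i)) -> cmeas D (fun t => \prod_(i <- s) u i t).
Proof.
move=> mu_; elim: s => [|i s IH].
  by under eq_fun do rewrite big_nil; exact: cmeas_cst.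
by under eq_fun do rewrite big_cons; exact: cmeasM.
Qed.

End square_integrable_gluing.

Section circle_functions.
Variable R : realType.
Local Notation leb := (@completed_lebesgue_measure R).
Local Notation lebT := (caratheodory_type (wlength (@idfun R))^*%mu).
Local Notation period := (@period R : set lebT).
Let mP : measurable (period : set lebT) := @measurable_period R.
Implicit Types (A : set R[i]) (F G : R[i] -> R[i]).

Definition on_angles F : lebT -> R[i] := fun t => F (expi t).

Lemma circle_expi (t : R) : @circle R (expi t).
Proof. by rewrite /circle /expi/= normc_def/= cos2Dsin2 sqrtr1. Qed.

Lemma angles_circle : angles (@circle R) = period.
Proof.
by apply/seteqP; split=> [t []//|t Pt]; split=> //; exact: circle_expi.
Qed.

Lemma nsq_norm1 (a : R[i]) : `|a| = 1 -> nsq a = 1.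
Proof.
move=> a1; have := add_Re2_Im2 a; rewrite a1 expr1n => /(congr1 (@complex.Re R)) /=.
by rewrite /nsq /dotc -!expr2.
Qed.

Lemma expi_inj (s t : R) : period s -> period t -> expi s = expi t -> s = t.
Proof.
wlog st : s t / s < t.
  move=> W; have [st|st|//] := ltgtP s t; first exact: W.
  by move=> Ps Pt e; rewrite (W t s).
move=> /andP[s0 sp] /andP[t0 tp] [ec es].
have : cos (t - s) = 1 by rewrite cosB ec es -!expr2 cos2Dsin2.
have -> : t - s = (t - s) / 2 *+ 2 by rewrite -mulr_natr; field.
have : 0 < sin ((t - s) / 2) by apply: sin_gt0_pi; apply/andP; split; lra.
rewrite cos_mulr2n cos2sin2 mulr2n => h1 h2.
have : 0 < sin ((t - s) / 2) ^+ 2 by rewrite exprn_gt0.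
lra.
Qed.

(** On the period a function of the angle is a function of the point, the angle
   being determined by the point. *)
Lemma on_angles_surj (u : lebT -> R[i]) :
  exists F, {in period, on_angles F =1 u}.
Proof.
exists (fun x => u (xget 0 [set t : R | period t /\ expi t = x])).
move=> t /set_mem Pt; rewrite /on_angles.
have : exists s : R, [set s : R | period s /\ expi s = expi t] s by exists t.
by move=> /(xgetPex 0) /= [Ps /(expi_inj Ps Pt) ->].
Qed.

(** [2 pi] times the square of [L2norm A F], infinite values included. *)
Definition mass A F : \bar R := (\int[leb]_(t in angles A) (nsq (F (expi t)))%:E)%E.

Lemma L2normE A F : L2norm A F = (((2 * pi)^-1%:E * mass A F) `^ 2^-1)%E.
Proof.
rewrite /L2norm /mass; congr (poweR (_ * _)%E _); apply: eq_integral => t _.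
rewrite /nsq /dotc; case: (F _) => x y /=.
by rewrite sqr_sqrtr -?expr2// addr_ge0// sqr_ge0.
Qed.

Let pi0 : 0 < (2 * pi)^-1 :> R.
Proof. by rewrite invr_gt0 mulr_gt0// pi_gt0. Qed.

Lemma L2norm_lty A F : (L2norm A F < +oo)%E -> (mass A F < +oo)%E.
Proof.
rewrite L2normE => /lty_poweRy; rewrite invr_eq0 pnatr_eq0 => /(_ isT).
by rewrite !ltey; apply: contra => /eqP ->; rewrite gt0_muley ?lte_fin.
Qed.

Lemma L2norm_fin A F (r : R) : 0 <= r -> mass A F = r%:E ->
  L2norm A F = (Num.sqrt ((2 * pi)^-1 * r))%:E.
Proof.
move=> r0 e; rewrite L2normE e -EFinM poweR_EFin powR12_sqrt//.
by rewrite mulr_ge0// ltW.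
Qed.

Lemma L2_sqint A F : L2 A F <-> sqint leb (angles A) (on_angles F) .
Proof.
split=> [[[m1 m2] fin]|[[m1 m2] iF]].
  have mF : cmeas (angles A : set lebT) (on_angles F) by split.
  split=> //; apply/integrableP; split.
    by apply/measurable_EFinP; exact: measurable_dotc.
  under eq_integral do rewrite gee0_abs ?lee_fin ?nsq_ge0//.
  exact: L2norm_lty fin.
split; first by split.
rewrite L2normE; apply: poweR_lty.
move: iF => /integrableP[_]; under eq_integral do rewrite gee0_abs ?lee_fin ?nsq_ge0//.
by move=> h; rewrite lte_mul_pinfty// lee_fin ltW.
Qed.

Lemma ip_chi_basis (u : lebT -> R[i]) n c : sqint leb period u ->
  ip leb period u (fun t => c * chi n t) =
  complex.Re c * ip leb period u (fun t => 1 * chi n t) +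
  complex.Im c * ip leb period u (fun t => 'i%C * chi n t).
Proof.
move=> su; have i1 := dot_integrable mP su (sqint_chi 1 n).
have i2 := dot_integrable mP su (sqint_chi 'i%C n).
rewrite /ip -(RintegralZl _ mP i1) -(RintegralZl _ mP i2).
rewrite -(RintegralD mP (integrableZR mP _ i1) (integrableZR mP _ i2)).
by apply: eq_Rintegral => t _; rewrite /dotc !ReIm/=; ring.
Qed.

Lemma fourierE F n : fourier F n =
  Complex ((2 * pi)^-1 * ip leb period (on_angles F) (fun t => 1 * chi n t))
          ((2 * pi)^-1 * ip leb period (on_angles F) (fun t => 'i%C * chi n t)).
Proof.
rewrite /fourier angles_circle /ip; congr (Complex (_ * _) (_ * _)).
- apply: eq_Rintegral => t _; rewrite -conjc_expi -/(chi n t) /on_angles /dotc.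
  by rewrite !ReIm/=; ring.
- apply: eq_Rintegral => t _; rewrite -conjc_expi -/(chi n t) /on_angles /dotc.
  by rewrite !ReIm/=; ring.
Qed.

Lemma H2_hardy F : H2 F <-> hardy (on_angles F).
Proof.
have fE n : fourier F n = 0 <->
    ip leb period (on_angles F) (fun t => 1 * chi n t) = 0 /\
    ip leb period (on_angles F) (fun t => 'i%C * chi n t) = 0.
  rewrite fourierE; split=> [[/eqP + /eqP]|[-> ->]]; last by rewrite mulr0.
  by rewrite !mulf_eq0 !(gt_eqF pi0)/= => /eqP -> /eqP ->.
rewrite /H2 L2_sqint angles_circle; split=> -[sF hF]; split=> // n n0.
  by move=> c; rewrite ip_chi_basis// ((fE n).1 (hF n n0)).1
    ((fE n).1 (hF n n0)).2 !mulr0 addr0.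
by apply/fE; rewrite !hF.
Qed.

Lemma eq_hardy (u v : lebT -> R[i]) : {in period, u =1 v} -> hardy u -> hardy v.
Proof.
move=> uv [su hu]; split; first exact: eq_sqint su.
move=> n n0 c; rewrite -(hu n n0 c).
by apply: eq_Rintegral => t Pt; rewrite uv.
Qed.

(** For [|x| = 1], [1 - a^* x] is [x] times the conjugate of [x - a]. *)
Lemma norm_blaschke_factor (a x : R[i]) : `|a| < 1 -> `|x| = 1 ->
  `|(x - a) / (1 - a^* * x)| = 1.
Proof.
move=> a1 x1; have xx : x * x^* = 1 by rewrite -normCK x1 expr1n.
have e : `|x - a| = `|1 - a^* * x|.
  rewrite -norm_conjC rmorphB -[LHS]mul1r -[in LHS]x1 -normrM mulrBr xx.
  by rewrite [x * _]mulrC.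
have n0 : 1 - a^* * x != 0.
  apply: contraTneq a1 => /eqP; rewrite subr_eq0 => /eqP /(congr1 Num.norm).
  by rewrite normrM norm_conjC x1 mulr1 normr1 => <-; rewrite ltxx.
by rewrite normrM normfV e divff// normr_eq0.
Qed.

Lemma norm_blaschke (phi0 : R) N (z : 'I_N -> R[i]) (t : R) :
  (forall j, `|z j| < 1) -> nsq (blaschke phi0 z (expi t)) = 1.
Proof.
move=> z1; apply: nsq_norm1; rewrite /blaschke normrM (circle_expi phi0) mul1r.
rewrite normr_prod big1// => j _; apply: norm_blaschke_factor => //.
exact: circle_expi.
Qed.

Lemma cmeas_blaschke (phi0 : R) N (z : 'I_N -> R[i]) :
  cmeas period (on_angles (blaschke phi0 z)).
Proof.
have me : cmeas period (expi : lebT -> R[i]).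
  apply: eq_cmeas (cmeas_chi R 1) => t _.
  by rewrite /chi mul1r.
apply: (cmeasM (cmeas_cst _ _)); apply: cmeas_prod => j; apply: cmeasM.
  exact: (cmeasD me (cmeas_cst _ _)).
apply: (cmeasV mP); apply: (cmeasD (cmeas_cst _ _)); apply: cmeasN.
exact: (cmeasM (cmeas_cst _ _) me).
Qed.

End circle_functions.

(** * Removal of the interpolation data *)

#[local] Opaque ip nrm2.

Section reduction.
Variable R : realType.
Local Notation leb := (@completed_lebesgue_measure R).
Local Notation lebT := (caratheodory_type (wlength (@idfun R))^*%mu).
Local Notation period := (@period R : set lebT).
Local Notation nrm2 := (nrm2 leb).
Let mP : measurable (period : set lebT) := @measurable_period R.
Variables (I J : set R[i]) (psi b f h : R[i] -> R[i]).
Hypotheses (mI : circle_measurable I) (mJ : circle_measurable J).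
Hypothesis IJ : angles I `|` angles J = period.
Hypothesis disjIJ : angles I `&` angles J = set0.
Hypotheses (hf : L2 I f) (hh : L2 J h) (hpsi : H2 psi).
Hypothesis mb : cmeas period (on_angles b).
Hypothesis b1 : forall t : R, nsq (b (expi t)) = 1.
Local Notation A := (angles I : set lebT).
Local Notation B := (angles J : set lebT).

(** As [b] is unimodular on the circle, [psi + b * g] is as far from the data
   as [g] is from this function. *)
Definition target : lebT -> R[i] := fun t => conjc (b (expi t)) *
  ((if t \in A then f (expi t) else h (expi t)) - psi (expi t)).

Lemma sqint_target : sqint leb period target.
Proof.
have [spsi _] := (H2_hardy psi).1 hpsi.
have sfh : sqint leb period
    (fun t => if t \in A then f (expi t) else h (expi t)).
  rewrite -IJ; apply: (sqint_setU mI mJ disjIJ).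
    by apply: (eq_sqint mI _ ((L2_sqint _ _).1 hf)) => t ->.
  apply: (eq_sqint mJ _ ((L2_sqint _ _).1 hh)) => t /set_mem Bt.
  rewrite memNset// => At.
  by have : (A `&` B) t by []; rewrite disjIJ.
apply: (@sqintM _ _ _ leb period mP _ _ 1 (cmeasJ mb) _ (sqintB mP sfh spsi)).
by move=> t _; rewrite nsqJ b1.
Qed.

Lemma nsq_unimodular (c x g y : R[i]) : nsq c = 1 ->
  nsq (x + c * g - y) = nsq (g - conjc c * (y - x)).
Proof.
move=> c1; have cc : c * conjc c = 1.
  case: c c1 => u v; rewrite /nsq /dotc/= => c1.
  by apply/eqP; rewrite eq_complex/= mulrN opprK c1 mulrN mulrC addNr !eqxx.
rewrite (_ : x + c * g - y = c * (g - conjc c * (y - x))) ?nsqM ?c1 ?mul1r//.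
by rewrite mulrBr mulrA cc; ring.
Qed.

Lemma mass_restrict (S : set R[i]) (g y : R[i] -> R[i]) : circle_measurable S ->
  angles S `<=` period -> sqint leb period (on_angles g) ->
  (forall t, angles S t -> y (expi t) =
    if t \in A then f (expi t) else h (expi t)) ->
  mass S (fun x => psi x + b x * g x - y x) =
  (nrm2 (angles S) (fun t => on_angles g t - target t))%:E.
Proof.
move=> mS SP sg yE; rewrite nrm2E fineK.
  apply: eq_integral => t /set_mem St; congr EFin.
  by rewrite (nsq_unimodular _ _ _ (b1 t)) yE.
apply: (integrable_fin_num mS).
exact: (nsq_integrable mP mS SP (sqintB mP sg sqint_target)).
Qed.

Lemma L2norm_restrict (S : set R[i]) (g y : R[i] -> R[i]) : circle_measurable S ->
  angles S `<=` period -> sqint leb period (on_angles g) ->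
  (forall t, angles S t -> y (expi t) =
    if t \in A then f (expi t) else h (expi t)) ->
  L2norm S (fun x => psi x + b x * g x - y x) = (Num.sqrt
    ((2 * pi)^-1 * nrm2 (angles S) (fun t => on_angles g t - target t)))%:E.
Proof.
move=> mS SP sg yE; apply: L2norm_fin; first exact: nrm2_ge0.
exact: mass_restrict.
Qed.

Let IP : angles I `<=` period. Proof. by rewrite -IJ => t; left. Qed.
Let JP : angles J `<=` period. Proof. by rewrite -IJ => t; right. Qed.

Let fE t : angles I t -> f (expi t) = if t \in A then f (expi t) else h (expi t).
Proof. by move=> At; rewrite mem_set. Qed.

Let hE t : angles J t -> h (expi t) = if t \in A then f (expi t) else h (expi t).
Proof.
move=> Bt; rewrite memNset// => At.
by have : (A `&` B) t by []; rewrite disjIJ.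
Qed.

Let pi0 : 0 < (2 * pi)^-1 :> R.
Proof. by rewrite invr_gt0 mulr_gt0// pi_gt0. Qed.

Lemma admissibleP (M : R) g : 0 <= M -> admissible J psi b h M g <->
  hardy (on_angles g) /\
  nrm2 B (fun t => on_angles g t - target t) <= 2 * pi * M ^+ 2.
Proof.
move=> M0; rewrite /admissible H2_hardy.
suff E : hardy (on_angles g) ->
    (L2norm J (fun x => psi x + b x * g x - h x)%R <= M%:E)%E =
    (nrm2 B (fun t => on_angles g t - target t) <= 2 * pi * M ^+ 2).
  by split=> -[hg]; [rewrite E|rewrite -E].
move=> [sg _]; rewrite (L2norm_restrict mJ JP sg hE) lee_fin.
rewrite -[X in _ <= X](ger0_norm M0) -sqrtr_sqr ler_sqrt ?sqr_ge0//.
by rewrite mulrC ler_pdivrMr ?mulr_gt0 ?pi_gt0// [M ^+ 2 * _]mulrC.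
Qed.

Lemma L2norm_I_le g g' : hardy (on_angles g) -> hardy (on_angles g') ->
  (L2norm I (fun x => psi x + b x * g x - f x)%R <=
   L2norm I (fun x => psi x + b x * g' x - f x)%R)%E =
  (nrm2 A (fun t => on_angles g t - target t) <=
   nrm2 A (fun t => on_angles g' t - target t)).
Proof.
move=> [sg _] [sg' _].
rewrite (L2norm_restrict mI IP sg fE) (L2norm_restrict mI IP sg' fE) lee_fin.
by rewrite ler_sqrt ?ler_pM2l// mulr_ge0 ?nrm2_ge0// ltW.
Qed.

Theorem bep_unique_solution (M : R) : (0 < leb A)%E -> 0 <= M ->
  (M = 0 -> exists g, admissible J psi b h M g) ->
  exists g0, bep_solution I J f h psi b M g0 /\
    forall g, bep_solution I J f h psi b M g -> circle_ae_eq g g0.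
Proof.
move=> A0 M0 hM0; pose M2 := 2 * pi * M ^+ 2.
(* Density gives feasibility for a positive bound only. *)
have feasible : exists2 g : lebT -> R[i], hardy g &
    nrm2 B (fun t => g t - target t) <= M2.
  have := M0; rewrite le_eqVlt => /orP[/eqP M_0|Mp].
    have [g /(admissibleP g M0) [hg gM]] := hM0 (esym M_0).
    by exists (on_angles g).
  apply: (hardy_dense mI mJ IJ disjIJ A0 sqint_target).
  by rewrite !mulr_gt0 ?pi_gt0 ?exprn_gt0.
have [u0 [hu0 u0M u0min u0uniq]] :=
  hardy_extremal mI mJ IJ disjIJ A0 sqint_target feasible.
have [g0 g0E] := on_angles_surj u0.
have nE S : S `<=` period -> nrm2 S (fun t => on_angles g0 t - target t) =
    nrm2 S (fun t => u0 t - target t).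
  move=> SP; rewrite !nrm2E; apply: eq_Rintegral => t /set_mem St.
  by rewrite g0E// mem_set//; exact: SP.
have hg0 : hardy (on_angles g0).
  by apply: eq_hardy hu0 => t Pt; rewrite g0E.
have adm0 : admissible J psi b h M g0.
  by apply/(admissibleP g0 M0); split=> //; rewrite (nE B JP).
exists g0; split.
  split=> // g /(admissibleP g M0) [hg gM].
  by rewrite (L2norm_I_le hg0 hg) (nE A IP); exact: u0min.
move=> g [/(admissibleP g M0) [hg gM] /(_ g0 adm0)].
rewrite (L2norm_I_le hg hg0) (nE A IP) => gmin.
apply: completed_aeS (u0uniq _ hg gM gmin) => t gu Pt.
by have := gu Pt; rewrite -(g0E t (mem_set Pt)).
Qed.

End reduction.

Theorem theorem1 (R : realType) (I J : set R[i])
  (hI : I `<=` circle) (hJ : J = circle `\` I)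
  (mI : circle_measurable I) (mJ : circle_measurable J)
  (I_gt0 : (0 < circle_measure I)%E) (J_gt0 : (0 < circle_measure J)%E)
  (N : nat) (z : 'I_N -> R[i]) (z_inj : injective z)
  (z_disk : forall j, `|z j| < 1)
  (phi0 : R) (hphi0 : 0 <= phi0 <= 2 * pi)
  (f h psi : R[i] -> R[i]) (hf : L2 I f) (hh : L2 J h) (hpsi : H2 psi)
  (M : R) (hM : 0 <= M)
  (hM0 : M = 0 -> exists g, admissible J psi (blaschke phi0 z) h M g) :
  exists g0 : R[i] -> R[i],
    bep_solution I J f h psi (blaschke phi0 z) M g0 /\
    forall g, bep_solution I J f h psi (blaschke phi0 z) M g ->
      circle_ae_eq g g0.
Proof.
have IJ : angles I `|` angles J = @period R.
  rewrite -angles_circle hJ; apply/seteqP; split=> [t [[Pt It]|[Pt [Ct _]]]|t [Pt Ct]].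
  - by split=> //; exact: hI.
  - by split.
  - by have [It|nIt] := pselect (I (expi t)); [left|right].
have disjIJ : angles I `&` angles J = set0.
  by rewrite hJ; apply/seteqP; split=> // t [[_ It] [_ [_]]].
have A0 : (0 < @completed_lebesgue_measure R (angles I))%E.
  move: I_gt0; rewrite /circle_measure lt0e => /andP[I0 _].
  rewrite lt0e measure_ge0 andbT; apply: contraNneq I0 => ->.
  by rewrite mule0.
exact: (bep_unique_solution mI mJ IJ disjIJ hf hh hpsi (cmeas_blaschke phi0 z)
  (fun t => norm_blaschke phi0 t z_disk) A0 hM hM0).
Qed.
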